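(* Let $a\ge 2$ and $k\ge 1$ be integers. Let $\Xi_1,\dots,\Xi_k$ be independent, identically distributed random variables with density $f_\Xi$, and let $\Theta_1,\dots,\Theta_k$ be independent, identically distributed random variables with density $f_\Theta$. Put $\Xi_{k+1}:=\Xi_1$ and $\Theta_{k+1}:=\Theta_1$. Then $$\sum_{n\in\mathbb{Z}}\frac{(-1)^{nk}}{(an+1)^k}=\left(\frac{\pi}{a}\csc\frac{\pi}{a}\right)^k\Bigl(\Pr\bigl(\Xi_i\Xi_{i+1}<1 \text{ for all } i\in\{1,\dots,k\}\bigr)+\Pr\bigl(\Theta_i\Theta_{i+1}<1\text{ for all } i\in\{1,\dots,k\}\bigr)\Bigr).$$
   Context: The densities are $f_{\Xi}(\xi)=\dfrac{\frac{a}{\pi}\sin(\frac{\pi}{a})}{1+\xi^a}$ for $\xi\ge 0$ and $f_{\Theta}(\theta)=\dfrac{\frac{a}{\pi}\sin(\frac{\pi}{a})\,\theta^{a-2}}{1+\theta^a}$ for $\theta\ge0$, both zero on the negative half-line. The sum over $\mathbb{Z}$ is understood as $\sum_{n\ge 0}+\sum_{n\le -1}$, each one-sided series summed in order of increasing $|n|$ (this matters only for $k=1$). *)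

(* Defs.v *)
From HB Require Import structures.
From mathcomp Require Import all_boot all_order all_algebra.
From mathcomp Require Import all_classical all_reals all_analysis.

Set Implicit Arguments.
Unset Strict Implicit.
Unset Printing Implicit Defensive.

Import Order.TTheory GRing.Theory Num.Theory.
Import numFieldNormedType.Exports.

Local Open Scope classical_set_scope.
Local Open Scope ring_scope.

Definition density_Xi (R : realType) (a : nat) (x : R) : R :=
  if 0 <= x then a%:R / pi * sin (pi / a%:R) / (1 + x ^+ a) else 0.

(* [a - 2] is truncated, which is harmless since [2 <= a] throughout; note that
   [x ^+ 0 = 1] also at [x = 0]. *)
Definition density_Theta (R : realType) (a : nat) (x : R) : R :=
  if 0 <= x then
    a%:R / pi * sin (pi / a%:R) * x ^+ (a - 2) / (1 + x ^+ a)
  else 0.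

Definition has_density (R : realType) (d : measure_display)
    (T : measurableType d) (P : probability T R) (X : {RV P >-> R})
    (f : R -> R) : Prop :=
  forall A : set R, measurable A ->
    distribution P X A = (\int[lebesgue_measure]_(x in A) (f x)%:E)%E.

Definition mutually_independent (R : realType) (d : measure_display)
    (T : measurableType d) (P : probability T R) (I : finType)
    (X : I -> {RV P >-> R}) : Prop :=
  forall (J : {set I}) (A : I -> set R), (forall i, measurable (A i)) ->
    P (\bigcap_(i in [set` J]) (X i @^-1` A i)) =
    (\prod_(i in J) P (X i @^-1` A i))%E.

(* Identity of the laws is contained in the common density [f]. *)
Definition iid_with_density (R : realType) (d : measure_display)
    (T : measurableType d) (P : probability T R) (I : finType)
    (X : I -> {RV P >-> R}) (f : R -> R) : Prop :=
  mutually_independent X /\ (forall i, has_density (X i) f).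

(* [ordS] is the cyclic successor, so the index after the last one is the
   first one; for [k = 1] the event is [X_1 * X_1 < 1]. *)
Definition cyclic_event (R : realType) (d : measure_display)
    (T : measurableType d) (P : probability T R) (k : nat)
    (X : 'I_k -> {RV P >-> R}) : set T :=
  [set w | forall i : 'I_k, X i w * X (ordS i) w < 1].

(* [u] sums to [l] over the integers: the series over [n >= 0] and over
   [n <= -1], each in order of increasing absolute value, both converge and
   their sums add up to [l]. *)
Definition int_sum_to (R : realType) (u : int -> R) (l : R) : Prop :=
  exists lp ln : R,
    [/\ series (fun n : nat => u n%:Z) @ \oo --> lp,
        series (fun n : nat => u (- (n.+1)%:Z)) @ \oo --> ln
      & lp + ln = l].

(* Main.v *)
Require Import Defs.
From HB Require Import structures.
From mathcomp Require Import all_boot all_order all_algebra.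
From mathcomp Require Import all_classical all_reals all_analysis.
From mathcomp Require Import measurable_realfun.
From mathcomp Require Import ring lra zify.
Import Order.TTheory GRing.Theory Num.Theory.
Import numFieldNormedType.Exports.
Local Open Scope classical_set_scope.
Local Open Scope ring_scope.

                                                                        
                                                                                
                                     
                                                                    

                                                                       
                                                                               
                                                                            
                                                                                 
                                                                                
                                                                         
                                                                               
                                                                                
                                                                                
                                                     

(** Let $w(x) = x^c/(1+x^a)$ on $[0,\infty)$ ([base_density]). Up to the constant $C =
    \frac{a}{\pi}\sin\frac{\pi}{a}$ it is $f_\Xi$ for $c = 0$ and $f_\Theta$ for $c = a-2$. With $k
    = m+1$, the core is [one_sided_series]: for iid $X_i$ of density $Cw$, the probability that all
    $X_iX_{i+1}<1$, divided by $C^k$, equals $\sum_{n\ge 0}(-1)^{nk}/(an+c+1)^k$. The case $c=0$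
    gives the nonnegative indices; since $-a(n+1)+1 = -(an+a-1)$, the case $c=a-2$ gives the
    negative ones.

    By independence the probability is $C^k$ times a trace: the integral of $\prod
    1[x_ix_{i+1}<1]\,w(x_i)$ over a cycle ([probability_cyclic_event]). Given a point $x$, write the
    next one as $y$ with $y^a = r^a/(1+x^a-r^a)$. Then $xy<1$ means just $r<1$. In the variable $p =
    x^a/(1+x^a)$ the step reads $p \mapsto r^a(1-p)$, and the weight becomes $r^c\,dr$ up to powers
    that cancel along the chain ([chain_base_density]). So every constraint but the closing one
    becomes a coordinate ranging freely over $[0,1)$, and the closing one becomes $p_{\mathrm{last}}
    + p_{\mathrm{first}} < 1$.

    The last $p$ is an affine function $\alpha+\beta r^a$ of the first one, $r^a$, where $\beta$ is
    $(-1)^m$ times a product of $a$-th powers. A second substitution evaluates the integral over $r$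
    as $\int_0^1 x^c/(1+\beta x^a)\,dx$ ([cyclic_integral0]). What remains is $\int_{[0,1]^k}\prod
    q_i^c/(1+(-1)^m\prod q_i^a)\,dq$ ([chain_base_density_iter_integral]). Expanding in a geometric
    series and using $\int_0^1 q^{an+c}\,dq = 1/(an+c+1)$ yields the sum. For even $k$ the terms are
    positive and may be integrated one by one; for odd $k$ an exact remainder is bounded, which also
    covers the conditionally convergent case $k=1$. *)

Set Implicit Arguments.
Unset Strict Implicit.
Unset Printing Implicit Defensive.

(** * Integration against a measure given by a density *)

Section density.
Local Open Scope ereal_scope.
Context d (T : measurableType d) (R : realType).
Variable mu : {measure set T -> \bar R}.

Import HBNNSimple.

(** The hypothesis on [nu] is the case of indicators; linearity gives simple functions and monotone
    convergence the rest. Keeping [nu] abstract lets the lemma serve both [density_measure] and the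
    law of a random variable. *)
Lemma ge0_integral_density (nu : {measure set T -> \bar R}) (g : T -> R)
    (f : T -> \bar R) :
  measurable_fun setT g -> (forall x, 0 <= g x)%R ->
  (forall A, measurable A -> nu A = \int[mu]_(x in A) (g x)%:E) ->
  measurable_fun setT f -> (forall x, 0 <= f x) ->
  \int[nu]_x f x = \int[mu]_x (f x * (g x)%:E).
Proof.
move=> mg g0 nuE mf f0.
have mgE : measurable_fun setT (EFin \o g) by exact/measurable_EFinP.
have gE0 x : 0 <= (g x)%:E by rewrite lee_fin.
pose h := nnsfun_approx measurableT mf.
have fE x : f x = lim ((EFin \o h n) x @[n --> \oo]).
  by apply/esym/cvg_lim => //; exact: cvg_nnsfun_approx.
transitivity (lim (\int[nu]_x (EFin \o h n) x @[n --> \oo])).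
  under eq_integral do rewrite fE.
  apply: monotone_convergence => //.
  - by move=> n; exact/measurable_EFinP/measurable_funP.
  - by move=> n x _; rewrite lee_fin.
  - by move=> x _ m n mn; rewrite lee_fin; exact/lefP/nd_nnsfun_approx.
have -> : \int[mu]_x (f x * (g x)%:E) =
    lim (\int[mu]_x ((EFin \o h n) x * (g x)%:E) @[n --> \oo]).
  have fgE x : f x * (g x)%:E = lim ((EFin \o h n) x * (g x)%:E @[n --> \oo]).
    apply/esym/cvg_lim => //; apply: cvgeZr => //.
    exact: cvg_nnsfun_approx.
  under eq_integral do rewrite fgE.
  apply: monotone_convergence => //.
  - move=> n; apply: emeasurable_funM => //.
    exact/measurable_EFinP/measurable_funP.
  - by move=> n x _; rewrite mule_ge0 ?lee_fin.
  - move=> x _ m n mn; rewrite lee_wpmul2r ?lee_fin//.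
    exact/lefP/nd_nnsfun_approx.
apply: congr_lim; apply/funext => n.
transitivity (\int[nu]_x
   (\sum_(y \in range (h n)) (y * \1_(h n @^-1` [set y]) x)%:E)).
  by apply: eq_integral => t tE; rewrite /= fimfunE -fsumEFin.
have indich r : measurable_fun setT (fun x => (r * \1_(h n @^-1` [set r]) x)%:E).
  by apply: (measurable_comp measurableT) => //; exact: measurable_funM.
rewrite ge0_integral_fsum//; last by move=> m y Ey; exact: nnfun_muleindic_ge0.
transitivity (\int[mu]_x (\sum_(y \in range (h n))
    (y * \1_(h n @^-1` [set y]) x)%:E * (g x)%:E)); last first.
  apply: eq_integral => x xE.
  rewrite -ge0_mule_fsuml => [|y]; last exact: nnfun_muleindic_ge0.
  by rewrite fsumEFin // -(fimfunE _ x).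
rewrite ge0_integral_fsum//; last 2 first.
  - by move=> y; exact: emeasurable_funM.
  - by move=> m y Ey; rewrite mule_ge0// nnfun_muleindic_ge0.
apply: eq_fsbigr => r rhn.
under eq_integral do rewrite EFinM.
rewrite integralZl_indic_nnsfun => //.
under [RHS]eq_integral do rewrite EFinM -muleA.
rewrite ge0_integralZl//.
- under [in RHS]eq_integral do rewrite muleC.
  rewrite [X in _ * X = _](_ : _ = nu (h n @^-1` [set r])); last first.
    by rewrite integral_indic// setIT.
  rewrite nuE; last exact: measurable_sfunP.
  congr (_ * _); rewrite integral_mkcond; apply: eq_integral => x _.
  by rewrite epatch_indic.
- by apply: emeasurable_funM => //; exact/measurable_EFinP.
- by move=> x _; rewrite mule_ge0// lee_fin.
- by move: rhn; rewrite inE => -[x _ <-]; rewrite lee_fin.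
Qed.

Variables (g : T -> R) (mg : measurable_fun setT g) (g0 : forall x, (0 <= g x)%R).

(** The two proofs are arguments so that the measure structure declared below can be inferred from
    the term itself. *)
Definition density_measure (_ : measurable_fun setT g)
    (_ : forall x, (0 <= g x)%R) (A : set T) : \bar R :=
  \int[mu]_(x in A) (g x)%:E.

Let density0 : density_measure mg g0 set0 = 0.
Proof. by rewrite /density_measure integral_set0. Qed.

Let density_ge0 A : 0 <= density_measure mg g0 A.
Proof. by apply: integral_ge0 => x _; rewrite lee_fin. Qed.

Let density_sigma_additive : semi_sigma_additive (density_measure mg g0).
Proof.
move=> /= F mF tF mUF; rewrite /density_measure; apply: cvg_toP.
  apply: ereal_nondecreasing_is_cvgn => m n mn.
  apply: lee_sum_nneg_natr => // k _ _; apply: integral_ge0 => /= x Fkx.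
  by rewrite lee_fin.
rewrite ge0_integral_bigcup//=.
- exact/measurable_funTS/measurableT_comp.
- by move=> x _; rewrite lee_fin.
Qed.

HB.instance Definition _ := isMeasure.Build _ _ _ (density_measure mg g0)
  density0 density_ge0 density_sigma_additive.

Lemma integral_density_measure (f : T -> \bar R) :
  measurable_fun setT f -> (forall x, 0 <= f x) ->
  \int[density_measure mg g0]_x f x = \int[mu]_x (f x * (g x)%:E).
Proof. exact: ge0_integral_density. Qed.

End density.

(** * Borel measures on the line are determined by left rays *)

Section real_measures.
Local Open Scope ereal_scope.
Variable R : realType.

(** Open left rays are stable under intersection, generate the Borel sets and exhaust the line;
    finiteness on them lets uniqueness of measures apply. *)
Lemma measure_eq_ray (m1 m2 : {measure set (measurableTypeR R) -> \bar R}) :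
  (forall t : R, m1 `]-oo, t[%classic = m2 `]-oo, t[%classic) ->
  (forall t : R, m1 `]-oo, t[%classic < +oo) ->
  forall A, measurable A -> m1 A = m2 A.
Proof.
move=> m12 m1oo.
apply: (@measure_unique _ R (measurableTypeR R) (@RGenInftyO.G R)
  (fun n => `]-oo, n%:R[%classic)).
- exact: RGenInftyO.measurableE.
- move=> _ _ [x ->] [y ->]; exists (Num.min x y).
  by apply/seteqP; split=> z /=; rewrite !in_itv/= lt_min => /andP.
- by move=> n; exists n%:R.
- rewrite -subTset => x _; exists (Num.truncn `|x|).+1 => //=.
  by rewrite in_itv/= (le_lt_trans (ler_norm x))// truncnS_gt.
- by move=> _ [x ->].
- by move=> n; exact: m1oo.
Qed.

End real_measures.

(** * The substitution $x^a = r^a/(K - B r^a)$ *)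

Section substitution.
Variables (R : realType) (a c : nat).
Hypothesis a_gt0 : (0 < a)%N.

Notation mu := (@lebesgue_measure R).

                                                                                 
                                                        
                                      
(** The relation $x^a = r^a/(K-Br^a)$ solved for $x$. It is meaningful only where $K - Br^a > 0$,
    since [powR] takes conventional values at nonpositive bases. *)
Definition root_subst (K B r : R) : R := r * (K - B * r ^+ a) `^ (- a%:R^-1).

(** The pullback of $x^c\,dx/(1+Bx^a)$ along [root_subst K B], as [root_subst_weight] checks. *)
Definition subst_weight (K B r : R) : R :=
  r ^+ c * (K - B * r ^+ a) `^ (- (c.+1%:R / a%:R)).

Let aR : a%:R != 0 :> R.
Proof. by rewrite pnatr_eq0 -lt0n. Qed.

Lemma root_subst_expr (K B r : R) : 0 < K - B * r ^+ a ->
  (root_subst K B r) ^+ a = r ^+ a / (K - B * r ^+ a).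
Proof.
move=> q0; rewrite /root_subst exprMn -(powR_mulrn _ (powR_ge0 _ _)) -powRrM.
by rewrite mulNr mulVf// powR_inv1 ?ltW.
Qed.

Let qE (K B : R) : (fun r : R => K - B * r ^+ a) =
  cst K + (- B) *: (@idfun R) ^+ a.
Proof. by apply/funext => r; rewrite !fctE /= scaleNr. Qed.

Lemma continuous_root_subst_base (K B : R) : continuous (fun r : R => K - B * r ^+ a).
Proof.
move=> r; apply: cvgB; first exact: cvg_cst.
apply: cvgM; [exact: cvg_cst | exact: exprn_continuous].
Qed.

Lemma is_derive_root_subst (K B r : R) : 0 < K - B * r ^+ a ->
  is_derive r 1 (root_subst K B) (K * (K - B * r ^+ a) `^ (- a%:R^-1 - 1)).
Proof.
move=> q0; set q := K - B * r ^+ a.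
have dq : is_derive r 1 (fun r : R => K - B * r ^+ a)
    (- B * (a%:R * r ^+ a.-1)).
  rewrite qE; apply: is_derive_eq.
  by rewrite add0r /GRing.scale /= mulr1.
have dp : is_derive r 1 (fun r : R => (K - B * r ^+ a) `^ (- a%:R^-1))
   (- B * (a%:R * r ^+ a.-1) * ( - a%:R^-1 * q `^ (- a%:R^-1 - 1))).
  have dpow := is_derive1_powR (- a%:R^-1) q0.
  have := @is_derive1_comp _ (fun y : R => y `^ (- a%:R^-1))
    (fun r : R => K - B * r ^+ a) r _ _ dpow dq.
  by move/is_derive_eq; apply; rewrite mulrC.
have -> : root_subst K B = (@idfun R) * (fun r : R => (K - B * r ^+ a) `^ (- a%:R^-1)).
  by [].
apply: is_derive_eq; rewrite /= /GRing.scale /= mulr1 -/q.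
(* The product rule yields $q^{-1/a-1}(Br^a + q)$, and $q + Br^a = K$. *)
have -> : q `^ (- a%:R^-1) = q `^ (- a%:R^-1 - 1) * q.
  rewrite -[X in _ * X]powRr1 ?(ltW q0)// -powRD; last by rewrite (gt_eqF q0) implybT.
  by rewrite subrK.
rewrite [in X in X + _](_ : r * _ = B * r ^+ a * q `^ (- a%:R^-1 - 1)).
  by rewrite /q; ring.
have ra : r ^+ a = r * r ^+ a.-1 by rewrite -exprS prednK.
by rewrite ra; field.
Qed.

Lemma root_subst_weight (K B r : R) : 0 < K -> 0 < K - B * r ^+ a ->
  (root_subst K B r) ^+ c / (1 + B * (root_subst K B r) ^+ a) *
    (K * (K - B * r ^+ a) `^ (- a%:R^-1 - 1)) = subst_weight K B r.
Proof.
move=> K0 q0; rewrite root_subst_expr// /subst_weight; set q := K - B * r ^+ a in q0 *.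
have qN0 := gt_eqF q0.
have -> : 1 + B * (r ^+ a / q) = K / q.
  by rewrite -[1](@divff _ q) ?qN0// mulrA -mulrDl /q subrK.
rewrite /root_subst -/q exprMn -(powR_mulrn _ (powR_ge0 _ _)) -powRrM.
(* The three exponents of $q$ come from $x^c$, from the derivative, and from $1/(1+Bx^a) = q/K$. *)
have -> : - (c.+1%:R / a%:R) = - a%:R^-1 * c%:R + (- a%:R^-1 - 1) + 1 :> R.
  by rewrite -natr1; ring.
rewrite (@powRD _ _ _ 1) ?qN0 ?implybT// powRr1 ?(ltW q0)//.
rewrite (@powRD _ _ (_ * _)) ?qN0 ?implybT//.
by field; rewrite qN0 (gt_eqF K0).
Qed.

(** The map is increasing on $[0,t]$ because its derivative $K q^{-1/a-1}$ is positive there. The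
    sign of [B] is left free: [cyclic_integral0] also applies this with [B] negative. *)
Lemma integral_root_subst (K B t : R) : 0 < K -> 0 <= t ->
  (forall r : R, 0 <= r <= t -> 0 < K - B * r ^+ a) ->
  (forall x : R, 0 <= x <= root_subst K B t -> 0 < 1 + B * x ^+ a) ->
  (\int[mu]_(x in `[0%R, root_subst K B t]) (x ^+ c / (1 + B * x ^+ a))%:E =
   \int[mu]_(r in `[0%R, t]) (subst_weight K B r)%:E)%E.
Proof.
move=> K0 t0 q0 x0.
have cov0 : root_subst K B 0 = 0 by rewrite /root_subst mul0r.
have dcov (r : R) : 0 <= r <= t -> 
    is_derive r 1 (root_subst K B) (K * (K - B * r ^+ a) `^ (- a%:R^-1 - 1)).
  by move=> /q0; exact: is_derive_root_subst.
have cc (r : R) : 0 <= r <= t -> {for r, continuous (root_subst K B)}.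
  move=> /dcov [d _]; apply/differentiable_continuous.
  exact/derivable1_diffP.
have D1 (r : R) : 0 < K - B * r ^+ a ->
    (derive1 (root_subst K B)) r = K * (K - B * r ^+ a) `^ (- a%:R^-1 - 1).
  by move=> /is_derive_root_subst [_ <-]; rewrite derive1E.
have cD (r : R) : 0 <= r <= t -> {for r, continuous (derive1 (root_subst K B))}.
  move=> rt; have qr := q0 _ rt.
  have near_q : \forall x \near r, 0 < K - B * x ^+ a.
    have := @continuous_root_subst_base K B r.
    by move/cvgrPdist_lt => /(_ _ qr); apply: filterS => x; rewrite ltr_distlC; lra.
  have cf : K * (K - B * x ^+ a) `^ (- a%:R^-1 - 1) @[x --> r] -->
      K * (K - B * r ^+ a) `^ (- a%:R^-1 - 1).
    have cq : (K - B * x ^+ a) `^ (- a%:R^-1 - 1) @[x --> r] -->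
      (K - B * r ^+ a) `^ (- a%:R^-1 - 1); last exact: cvgMl_tmp cq.
    apply: (@continuous_cvg _ _ _ _ _ _ (fun y : R => y `^ (- a%:R^-1 - 1))).
      have [d _] := is_derive1_powR (- a%:R^-1 - 1) qr.
      exact/differentiable_continuous/derivable1_diffP.
    exact: continuous_root_subst_base.
  rewrite /prop_for /continuous_at D1//; apply: cvg_trans cf.
  by apply: near_eq_cvg; apply: filterS near_q => x /D1 ->.
have ooW (r : R) : r \in `]0, t[ -> 0 <= r <= t.
  by rewrite in_itv/= => /andP[/ltW -> /ltW ->].
have t00 : 0 <= (0 : R) <= t by rewrite lexx.
have t0t : 0 <= t <= t by rewrite lexx andbT.
have Lc : derivable_oo_LRcontinuous (root_subst K B) 0 t.
  split.
  - by move=> r /ooW/dcov[].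
  - by apply: cvg_at_right_filter; exact: cc.
  - by apply: cvg_at_left_filter; exact: cc.
rewrite -[X in `[X, _]%classic]cov0.
rewrite integration_by_substitution_increasing//.
- apply: eq_integral => r; rewrite inE/= in_itv/= => rt; congr EFin.
  by rewrite !fctE D1 ?q0//= root_subst_weight// q0.
- apply: gtr0_derive1_lt_cc.
  + by move=> r /ooW/dcov[].
  + by move=> r /ooW/q0 q; rewrite D1// mulr_gt0// powR_gt0.
  + exact: derivable_oo_LRcontinuous_within.
- by move=> r /ooW/cD.
- by apply/cvg_ex; eexists; apply: cvg_at_right_filter; exact: cD.
- by apply/cvg_ex; eexists; apply: cvg_at_left_filter; exact: cD.
- apply: continuous_in_subspaceT => x; rewrite inE cov0/= in_itv/= => /x0 xp.
  apply: cvgM; first exact: exprn_continuous.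
  apply: cvgV; first by rewrite gt_eqF.
  have := @continuous_root_subst_base 1 (- B) x; rewrite /continuous_at mulNr opprK.
  by under eq_fun do rewrite mulNr opprK.
Qed.

Definition base_density (x : R) : R := if 0 <= x then x ^+ c / (1 + x ^+ a) else 0.

                                                                        
(** The density on $[0, K^{1/a})$ that [root_subst K 1] pushes forward to [base_density]; the cutoff
    removes the conventional values of [powR] beyond that interval. *)
Definition subst_density (K r : R) : R :=
  if (0 <= r) && (r ^+ a < K) then subst_weight K 1 r else 0.

Lemma base_density_ge0 x : 0 <= base_density x.
Proof.
by rewrite /base_density; case: ifP => // x0; rewrite divr_ge0 ?addr_ge0 ?exprn_ge0.
Qed.

Lemma subst_density_ge0 K r : 0 <= subst_density K r.
Proof.
rewrite /subst_density; case: ifP => // /andP[r0 _].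
by rewrite mulr_ge0 ?exprn_ge0 ?powR_ge0.
Qed.

Lemma measurable_powR_base (K B p : R) :
  measurable_fun setT (fun r : R => (K - B * r ^+ a) `^ p).
Proof.
apply: (measurableT_comp (measurable_powR p)).
by apply: continuous_measurable_fun; exact: continuous_root_subst_base.
Qed.

Lemma measurable_root_subst K B : measurable_fun setT (root_subst K B).
Proof. by apply: measurable_funM => //; exact: measurable_powR_base. Qed.

Lemma measurable_base_density : measurable_fun setT base_density.
Proof.
(* The inverse is written as a power with exponent $-1$, so that [measurable_powR_base] applies with
   $K = 1$ and $B = -1$. *)
have -> : base_density = fun x : R =>
    if 0 <= x then x ^+ c * (1 - (-1) * x ^+ a) `^ (-1) else 0.
  apply/funext => x; rewrite /base_density; case: ifP => // x0.
  by rewrite mulN1r opprK powR_inv1// addr_ge0// exprn_ge0.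
apply: measurable_fun_if => //; first exact: measurable_fun_ler.
apply: measurable_funTS; apply: measurable_funM; first exact: measurable_funX.
exact: measurable_powR_base.
Qed.

Lemma measurable_subst_density K : measurable_fun setT (subst_density K).
Proof.
apply: measurable_fun_if => //.
  by apply: measurable_and; [exact: measurable_fun_ler|
    apply: measurable_fun_ltr => //; exact: measurable_funX].
apply: measurable_funTS; apply: measurable_funM; first exact: measurable_funX.
exact: measurable_powR_base.
Qed.

Lemma integral_base_density_ray (t : R) :
  (\int[mu]_(x in `]-oo, t[) (base_density x)%:E =
   \int[mu]_(x in `[0%R, t]) (x ^+ c / (1 + 1 * x ^+ a))%:E)%E.
Proof.
transitivity (\int[mu]_(x in `[0%R, t[) (base_density x)%:E)%E.
  rewrite [LHS]integral_mkcond [RHS]integral_mkcond; apply: eq_integral => x _.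
  rewrite !patchE !mem_setE !in_itv/= /base_density.
  by case: (leP 0 x) => //= x0; case: ifP.
rewrite integral_itv_bndo_bndc; last first.
  by apply/measurable_EFinP/measurable_funTS; exact: measurable_base_density.
apply: eq_integral => x; rewrite inE/= in_itv/= => /andP[x0 _].
by rewrite /base_density x0 mul1r.
Qed.

Lemma integral_subst_density_ray (K t : R) : 0 < K -> 0 < t ->
  (\int[mu]_(r in root_subst K 1 @^-1` `]-oo, t[%classic) (subst_density K r)%:E =
   \int[mu]_(x in `[0%R, t]) (x ^+ c / (1 + 1 * x ^+ a))%:E)%E.
Proof.
move=> K0 t0; have ta : 0 < 1 + t ^+ a by rewrite addr_gt0// exprn_gt0.
(* The solution of [root_subst K 1 h = t]: from $t^a = h^a/(K-h^a)$ one gets $h^a = K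
   t^a/(1+t^a)$. *)
pose h := t * (K / (1 + t ^+ a)) `^ a%:R^-1.
have h0 : 0 <= h by rewrite mulr_ge0 ?powR_ge0 ?ltW.
have ha : h ^+ a = t ^+ a * (K / (1 + t ^+ a)).
  rewrite /h exprMn -(powR_mulrn _ (powR_ge0 _ _)) -powRrM mulVf// powRr1//.
  by rewrite divr_ge0 ?ltW.
have qh : K - 1 * h ^+ a = K / (1 + t ^+ a).
  by rewrite ha; field; rewrite gt_eqF.
have q0 (r : R) : 0 <= r <= h -> 0 < K - 1 * r ^+ a.
  move=> /andP[r0 rh]; apply: (@lt_le_trans _ _ (K - 1 * h ^+ a)).
    by rewrite qh divr_gt0.
  by rewrite !mul1r lerD2l lerN2 lerXn2r ?nnegrE.
have covh : root_subst K 1 h = t.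
  rewrite /root_subst qh /h -mulrA -powRD ?subrr ?powRr0 ?mulr1// ?eqxx/=.
  by rewrite mulf_neq0 ?invr_eq0 ?gt_eqF.
rewrite -[X in `[_, X]%classic]covh integral_root_subst// => [|x]; last first.
  by move=> /andP[x0 _]; rewrite mul1r ltr_wpDr// exprn_ge0.
transitivity (\int[mu]_(r in `[0%R, h[) (subst_density K r)%:E)%E; last first.
  rewrite integral_itv_bndo_bndc; last first.
    by apply/measurable_EFinP/measurable_funTS; exact: measurable_subst_density.
  apply: eq_integral => r; rewrite inE/= in_itv/= => /[dup] /andP[r0 _] /q0.
  by rewrite mul1r subr_gt0 /subst_density r0 => ->.
rewrite [LHS]integral_mkcond [RHS]integral_mkcond; apply: eq_integral => r _.
rewrite !patchE.
have -> : (r \in root_subst K 1 @^-1` `]-oo, t[%classic) = (root_subst K 1 r < t).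
  by apply/idP/idP; rewrite inE/= in_itv.
rewrite mem_setE in_itv/= /subst_density; case: (leP 0 r) => /= [r0|_].
  (* Inside the support the preimage of the ray is cut at [h], as comparing $a$-th powers shows. *)
  have E : r ^+ a < K -> (root_subst K 1 r < t) = (r < h).
    rewrite -subr_gt0 -[r ^+ a]mul1r => qr.
    rewrite -(ltr_pXn2r a_gt0) ?nnegrE ?(ltW t0)//; last first.
      by rewrite mulr_ge0 ?powR_ge0.
    rewrite root_subst_expr// -[in RHS](ltr_pXn2r a_gt0) ?nnegrE// ha.
    by rewrite ltr_pdivrMr// mulrA ltr_pdivlMr//; apply/idP/idP; lra.
  case: (ltP r h) => [rh|hr].
    have qr : 0 < K - 1 * r ^+ a by apply: q0; rewrite r0 ltW.
    by rewrite mul1r subr_gt0 in qr; rewrite E// rh.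
  case: ifP => // rt; case: ifP => // rK.
  by move: rt; rewrite E// ltNge hr.
by case: ifP.
Qed.

Lemma integral_base_density_rayoo (t : R) :
  (\int[mu]_(x in `]-oo, t[) (base_density x)%:E < +oo)%E.
Proof.
rewrite integral_base_density_ray.
have := @continuous_compact_integrable R (fun x => x ^+ c / (1 + 1 * x ^+ a))
  `[0, t]%classic (@segment_compact _ _ _).
have cG : {within `[0, t]%classic, continuous
    (fun x : R => x ^+ c / (1 + 1 * x ^+ a))}.
  apply: continuous_in_subspaceT => x; rewrite inE/= in_itv/= => /andP[x0 _].
  apply: cvgM; first exact: exprn_continuous.
  apply: cvgV; first by rewrite gt_eqF// mul1r ltr_wpDr// exprn_ge0.
  have := @continuous_root_subst_base 1 (- 1) x; rewrite /continuous_at mulNr opprK.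
  by under eq_fun do rewrite mulNr opprK.
move=> /(_ cG)/integrableP[_]; apply: le_lt_trans.
have mG := subspace_continuous_measurable_fun (measurable_itv `[0, t]) cG.
apply: ge0_le_integral => //=; last by move=> x _; rewrite lee_fin ler_norm.
- move=> x; rewrite in_itv/= => /andP[x0 _].
  by rewrite lee_fin mul1r divr_ge0 ?addr_ge0 ?exprn_ge0.
- exact/measurable_EFinP.
- by apply/measurable_EFinP; exact: measurableT_comp.
Qed.

                                                                              
                                    
(** The calculus substitution shows that two measures agree on left rays, hence on all Borel sets.
    Thus [f] may be any nonnegative measurable function, in particular one containing the
    discontinuous indicators of the chain. *)
Lemma integral_transfer (K : R) (f : R -> \bar R) : 0 < K ->
  measurable_fun setT f -> (forall x, 0 <= f x)%E ->
  (\int[mu]_x (f x * (base_density x)%:E) =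
   \int[mu]_r (f (root_subst K 1 r) * (subst_density K r)%:E))%E.
Proof.
move=> K0 mf f0.
pose m1 := density_measure mu measurable_base_density base_density_ge0.
pose m := density_measure mu (measurable_subst_density K) (subst_density_ge0 K).
transitivity (\int[m1]_x f x)%E; first by rewrite integral_density_measure.
transitivity (\int[m]_x (f \o root_subst K 1) x)%E; last first.
  rewrite integral_density_measure// => [|x]; last exact: f0.
  exact: measurableT_comp (measurable_root_subst K 1).
have mphi : measurable_fun [set: measurableTypeR R]
    (root_subst K 1 : _ -> measurableTypeR R) by exact: measurable_root_subst.
have := ge0_integral_pushforward mphi m measurableT (f := f) mf (fun y _ => f0 y).
rewrite preimage_setT => <-.
apply: eq_measure_integral => A mA _.
apply: (@measure_eq_ray R m1
  (pushforward m (root_subst K 1 : _ -> measurableTypeR R))) => [t|t|]//.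
  transitivity (\int[mu]_(x in `]-oo, t[) (base_density x)%:E)%E; first by [].
  transitivity (\int[mu]_(r in root_subst K 1 @^-1` `]-oo, t[%classic)
    (subst_density K r)%:E)%E; last by [].
  case: (ltP 0 t) => t0; first by rewrite integral_base_density_ray integral_subst_density_ray.
  rewrite !integral0_eq// => x /=; rewrite in_itv/= => /lt_le_trans/(_ t0).
    rewrite /subst_density; case: ifP => // /andP[x0 _].
    by rewrite ltNge mulr_ge0 ?powR_ge0.
  by rewrite /base_density ltNge => /negbTE ->.
exact: integral_base_density_rayoo.
Qed.

End substitution.

(** * Linearity, series and Tonelli for integrals with a weight *)

Section weighted_integral.
Local Open Scope ereal_scope.
Variable R : realType.
Implicit Types (w : R -> R) (f g : R -> \bar R).

Notation mu := (@lebesgue_measure R).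

Definition weighted_integral w f : \bar R := \int[mu]_x (f x * (w x)%:E).

Lemma eq_weighted_integral w f g : (forall x, w x != 0%R -> f x = g x) ->
  weighted_integral w f = weighted_integral w g.
Proof.
move=> fg; apply: eq_integral => x _.
by have [->|/fg ->//] := eqVneq (w x) 0%R; rewrite !mule0.
Qed.

Section nonnegative_weight.
Variable w : R -> R.
Hypothesis w0 : forall x, (0 <= w x)%R.

Lemma weighted_integral_ge0 f : (forall x, 0 <= f x) -> 0 <= weighted_integral w f.
Proof. by move=> f0; apply: integral_ge0 => x _; rewrite mule_ge0// lee_fin. Qed.

Hypothesis mw : measurable_fun setT w.

Lemma measurable_weighted_integrand d (T : measurableType d) (h : T -> \bar R)
    (k : T -> R) :
  measurable_fun setT h -> measurable_fun setT k ->
  measurable_fun setT (fun x => h x * (w (k x))%:E).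
Proof.
move=> mh mk; apply: emeasurable_funM => //.
apply/measurable_EFinP; exact: measurableT_comp.
Qed.

Lemma weighted_integralZl (k : R) f : measurable_fun setT f -> (forall x, 0 <= f x) ->
  (0 <= k)%R -> weighted_integral w (fun x => k%:E * f x) = k%:E * weighted_integral w f.
Proof.
move=> mf f0 k0; rewrite /weighted_integral -ge0_integralZl//.
- by apply: eq_integral => x _; rewrite muleA.
- exact: measurable_weighted_integrand.
- by move=> x _; rewrite mule_ge0// lee_fin.
Qed.

Lemma weighted_integralD f g : measurable_fun setT f -> measurable_fun setT g ->
  (forall x, 0 <= f x) -> (forall x, 0 <= g x) ->
  weighted_integral w (fun x => f x + g x) = weighted_integral w f + weighted_integral w g.
Proof.
move=> mf mg f0 g0; rewrite /weighted_integral -ge0_integralD//.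
- by apply: eq_integral => x _; rewrite ge0_muleDl.
- by move=> x _; rewrite mule_ge0// lee_fin.
- exact: measurable_weighted_integrand.
- by move=> x _; rewrite mule_ge0// lee_fin.
- exact: measurable_weighted_integrand.
Qed.

Lemma weighted_integral_nneseries (f : (R -> \bar R)^nat) :
  (forall n, measurable_fun setT (f n)) -> (forall n x, 0 <= f n x) ->
  weighted_integral w (fun x => \sum_(n <oo) f n x) = \sum_(n <oo) weighted_integral w (f n).
Proof.
move=> mf f0; rewrite /weighted_integral -integral_nneseries//.
- apply: eq_integral => x _; rewrite muleC -nneseriesZl//.
  by apply: eq_eseriesr => n _; rewrite muleC.
- by move=> n; exact: (measurable_weighted_integrand (mf n)).
- by move=> n x _; rewrite mule_ge0// lee_fin.
Qed.

Lemma measurable_weighted_integral d (T : measurableType d) (f : T * R -> \bar R) :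
  measurable_fun setT f -> (forall x, 0 <= f x) ->
  measurable_fun setT (fun t => weighted_integral w (fun x => f (t, x))).
Proof.
move=> mf f0.
apply: (@measurable_fun_fubini_tonelli_F _ _ _ _ _ mu
   (fun p => f p * (w p.2)%:E)).
  exact: (@measurable_weighted_integrand _ (T * measurableTypeR R)%type f snd).
by move=> x; rewrite mule_ge0// lee_fin.
Qed.

End nonnegative_weight.

Lemma weighted_integral_swap (w1 w2 : R -> R) (f : R * R -> \bar R) :
  (forall x, (0 <= w1 x)%R) -> (forall x, (0 <= w2 x)%R) ->
  measurable_fun setT w1 -> measurable_fun setT w2 ->
  measurable_fun setT f -> (forall x, 0 <= f x) ->
  weighted_integral w1 (fun x => weighted_integral w2 (fun y => f (x, y))) =
  weighted_integral w2 (fun y => weighted_integral w1 (fun x => f (x, y))).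
Proof.
move=> w10 w20 mw1 mw2 mf f0.
have E1 x : weighted_integral w2 (fun y => f (x, y)) * (w1 x)%:E =
    \int[mu]_y (f (x, y) * (w1 x)%:E * (w2 y)%:E).
  rewrite muleC /weighted_integral -ge0_integralZl//.
  - by apply: eq_integral => y _; rewrite muleCA muleA.
  - apply: measurable_weighted_integrand => //; exact: measurableT_comp.
  - by move=> y _; rewrite mule_ge0// lee_fin.
  - by rewrite lee_fin.
have E2 y : weighted_integral w1 (fun x => f (x, y)) * (w2 y)%:E =
    \int[mu]_x (f (x, y) * (w1 x)%:E * (w2 y)%:E).
  rewrite muleC /weighted_integral -ge0_integralZl//.
  - by apply: eq_integral => x _; rewrite muleC.
  - apply: measurable_weighted_integrand => //; exact: measurableT_comp.
  - by move=> x _; rewrite mule_ge0// lee_fin.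
  - by rewrite lee_fin.
rewrite {1}/weighted_integral [RHS]/weighted_integral; under eq_integral do rewrite E1.
under [RHS]eq_integral do rewrite E2.
apply: (@fubini_tonelli _ _ _ _ _ mu mu
  (fun p : measurableTypeR R * measurableTypeR R => f p * (w1 p.1)%:E * (w2 p.2)%:E)).
  apply: (measurable_weighted_integrand mw2) => //.
  exact: (measurable_weighted_integrand mw1).
by move=> x; rewrite !mule_ge0// lee_fin.
Qed.

End weighted_integral.

(** * Iterates of the kernel $1[xy<1]$ *)

Section chain.
Local Open Scope ereal_scope.
Variable R : realType.

                                                                         
                                           
(** The kernel of the $(m+1)$-st power of the integral operator with kernel $1[xy<1]$ and weight
    [w]: [m] intermediate points are integrated out. Both end points form one argument, so that
    joint measurability is a statement about a single function. *)
Fixpoint chain (w : R -> R) (m : nat) (p : R * R) : \bar R :=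
  if m is m'.+1 then
    weighted_integral w (fun y => ((p.1 * y < 1)%R%:R)%:E * chain w m' (y, p.2))
  else ((p.1 * p.2 < 1)%R%:R)%:E.

Variable w : R -> R.
Hypotheses (w0 : forall x, (0 <= w x)%R) (mw : measurable_fun setT w).

Lemma measurable_lt1 d (T : measurableType d) (f : T -> R) :
  measurable_fun setT f ->
  measurable_fun setT (fun x => (((f x < 1)%R%:R)%:E : \bar R)).
Proof.
move=> mf; apply/measurable_EFinP.
have -> : (fun x => ((f x < 1)%R%:R : R)) =
    (fun x => if (f x < 1)%R then 1%R else 0%R).
  by apply/funext => x; case: ifP.
by apply: measurable_fun_if => //; exact: measurable_fun_ltr.
Qed.

Lemma chain_ge0 m p : 0 <= chain w m p.
Proof.
elim: m p => [|m IH] p /=; first by rewrite lee_fin.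
by apply: weighted_integral_ge0 => // y; rewrite mule_ge0 ?lee_fin.
Qed.

Lemma measurable_chain_step m : measurable_fun setT (chain w m) ->
  measurable_fun setT
    (fun q : R * R * R => ((q.1.1 * q.2 < 1)%R%:R)%:E * chain w m (q.2, q.1.2)).
Proof.
move=> mm; apply: emeasurable_funM.
  apply: measurable_lt1; apply: measurable_funM => //.
  exact: measurableT_comp.
apply: (measurableT_comp mm); apply/measurable_fun_pair => //=.
exact: measurableT_comp.
Qed.

Lemma measurable_chain m : measurable_fun setT (chain w m).
Proof.
elim: m => [|m IH] /=.
  by apply: measurable_lt1; exact: measurable_funM.
have := measurable_weighted_integral w0 mw (measurable_chain_step IH); apply => q.
by rewrite mule_ge0 ?lee_fin ?chain_ge0.
Qed.

Lemma measurable_chain_step1 m (p : R * R) : measurable_fun setT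
  (fun y => ((p.1 * y < 1)%R%:R)%:E * chain w m (y, p.2)).
Proof.
apply: emeasurable_funM; first by apply: measurable_lt1; exact: measurable_funM.
apply: (measurableT_comp (measurable_chain m)).
exact/measurable_fun_pair.
Qed.

Lemma measurable_chain_diag m : measurable_fun setT (fun x => chain w m (x, x)).
Proof.
apply: (measurableT_comp (measurable_chain m)).
exact/measurable_fun_pair.
Qed.

Lemma chain_scale (k : R) m p : (0 <= k)%R ->
  chain (fun x => k * w x)%R m p = (k ^+ m)%:E * chain w m p.
Proof.
move=> k0; elim: m p => [|m IH] p /=; first by rewrite mul1e.
rewrite -weighted_integralZl ?exprn_ge0//; last 2 first.
- exact: measurable_chain_step1.
- by move=> y; rewrite mule_ge0 ?lee_fin ?chain_ge0.
apply: eq_integral => y _; rewrite IH exprS !EFinM -!muleA.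
rewrite (muleCA (chain w m _) k%:E) (muleCA (k ^+ m)%:E k%:E).
by rewrite (muleCA (_%:R)%:E k%:E) (muleCA (_%:R)%:E (k ^+ m)%:E).
Qed.

End chain.

(** * The chain in straightened coordinates *)

Section kernel.
Variables (R : realType) (a c : nat).
Hypothesis a_gt0 : (0 < a)%N.

Notation s := (c.+1%:R / a%:R : R).

Definition unit_density (r : R) : R := if 0 <= r < 1 then r ^+ c else 0.

Lemma unit_density_ge0 r : 0 <= unit_density r.
Proof. by rewrite /unit_density; case: ifP => // /andP[r0 _]; rewrite exprn_ge0. Qed.

Lemma measurable_unit_density : measurable_fun setT unit_density.
Proof.
apply: measurable_fun_if => //.
by apply: measurable_and; [exact: measurable_fun_ler|exact: measurable_fun_ltr].
Qed.

Lemma unit_density_neq0 r : unit_density r != 0 -> 0 <= r < 1.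
Proof. by rewrite /unit_density; case: ifP => //; rewrite eqxx. Qed.

Local Open Scope ereal_scope.

                                                                              
(** The form that [chain] takes in the coordinate $p = x^a/(1+x^a)$, up to a factor: each step is $p
    \mapsto r^a(1-p)$ with $r$ free in $[0,1)$, and only the last link survives as a constraint. *)
Fixpoint path_kernel (m : nat) (p : R * R) : \bar R :=
  if m is m'.+1 then
    weighted_integral unit_density (fun r => path_kernel m' (r ^+ a * (1 - p.1), p.2)%R)
  else ((1 - p.1) `^ (- s) * (p.1 + p.2 < 1)%R%:R)%:E.

Lemma path_kernel_ge0 m p : 0 <= path_kernel m p.
Proof.
elim: m p => [|m IH] p /=; first by rewrite lee_fin mulr_ge0 ?powR_ge0.
by apply: weighted_integral_ge0 => //; exact: unit_density_ge0.
Qed.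

Lemma measurable_path_kernel m : measurable_fun setT (path_kernel m).
Proof.
elim: m => [|m IH] /=.
  rewrite [X in measurable_fun _ X](_ : _ = fun p : R * R =>
     ((1 - p.1) `^ (- s))%:E * ((p.1 + p.2 < 1)%R%:R)%:E); last first.
    by apply/funext => p; rewrite EFinM.
  apply: emeasurable_funM; last first.
    by apply: measurable_lt1; exact: measurable_funD.
  apply/measurable_EFinP/(measurableT_comp (measurable_powR _)).
  exact: measurable_funB.
apply: (measurable_weighted_integral unit_density_ge0 measurable_unit_density
  (f := fun q : R * R * R => path_kernel m (q.2 ^+ a * (1 - q.1.1), q.1.2)%R)).
  apply: (measurableT_comp IH); apply/measurable_fun_pair => /=.
    apply: measurable_funM; first exact: measurable_funX.
    by apply: measurable_funB => //; exact: measurableT_comp.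
  exact: measurableT_comp.
by move=> q; exact: path_kernel_ge0.
Qed.

End kernel.

(** * From the chain to the path kernel *)

Section kernel.
Variables (R : realType) (a c : nat).
Hypothesis a_gt0 : (0 < a)%N.

Notation s := (c.+1%:R / a%:R : R).
Notation mu := (@lebesgue_measure R).
Notation nd := (@unit_density R c).
Notation U := (@path_kernel R a c).

Lemma subst_density_neq0 (K r : R) :
  subst_density a c K r != 0 -> 0 <= r /\ 0 < K - 1 * r ^+ a.
Proof.
by rewrite /subst_density mul1r subr_gt0; case: ifP => [/andP[]//|]; rewrite eqxx.
Qed.

Lemma root_subst1_ratio (K r : R) : 0 < K -> 0 < K - 1 * r ^+ a ->
  1 + root_subst a K 1 r ^+ a = K / (K - 1 * r ^+ a).
Proof.
by move=> K0 q0; rewrite root_subst_expr//; field; rewrite -[r ^+ a]mul1r gt_eqF.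
Qed.

(** Clearing denominators, $p(1+q)+q(1+p) < (1+p)(1+q)$ reduces to $pq<1$. This makes the closing
    link linear in the new coordinates. *)
Lemma ratio_sum_lt1 (p q : R) : 0 <= p -> 0 <= q ->
  (p / (1 + p) + q / (1 + q) < 1) = (p * q < 1).
Proof.
move=> p0 q0; have p1 : 0 < 1 + p by rewrite ltr_wpDr.
have q1 : 0 < 1 + q by rewrite ltr_wpDr.
have -> : p / (1 + p) + q / (1 + q) =
    (p * (1 + q) + q * (1 + p)) / ((1 + p) * (1 + q)).
  by field; rewrite !gt_eqF.
rewrite ltr_pdivrMr ?mulr_gt0//; apply/idP/idP; nra.
Qed.

Local Open Scope ereal_scope.

(** Induction on [m], substituting in the next variable with $K = 1+x^a$. The prefactor is the right
    one because it reproduces itself: $(K/q)^{-s}q^{-s} = K^{-s}$ with $q = K-r^a$. For [m = 0] it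
    cancels against $(1-p)^{-s}$. *)
Lemma chain_base_density m (x z : R) : (0 <= x)%R -> (0 <= z)%R ->
  chain (@base_density R a c) m (x, z) =
  ((1 + x ^+ a) `^ (- s))%:E *
    U m (x ^+ a / (1 + x ^+ a), z ^+ a / (1 + z ^+ a))%R.
Proof.
have onea (y : R) : (0 <= y)%R -> (0 < 1 + y ^+ a)%R.
  by move=> y0; rewrite ltr_wpDr// exprn_ge0.
have lt1a (y : R) : (0 <= y)%R -> (y < 1)%R = (y ^+ a < 1)%R.
  by move=> y0; rewrite expr_lt1.
elim: m x z => [|m IH] x z x0 z0 /=.
  have xa := onea _ x0; have za := onea _ z0.
  have -> : (1 - x ^+ a / (1 + x ^+ a) = (1 + x ^+ a)^-1)%R.
    by field; rewrite gt_eqF.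
  rewrite -EFinM mulrA -powRM ?invr_ge0 ?(ltW xa)// mulfV ?gt_eqF//.
  by rewrite powR1 mul1r lt1a ?mulr_ge0// exprMn ratio_sum_lt1// exprn_ge0.
have K0 := onea _ x0; set K := (1 + x ^+ a)%R in K0 *.
have K1 : (1 <= K)%R by rewrite /K lerDl exprn_ge0.
rewrite [LHS](@integral_transfer R a c a_gt0 K (fun y =>
  ((x * y < 1)%R%:R)%:E * chain (base_density a c) m (y, z)))//; last 2 first.
- exact: (measurable_chain_step1 (@base_density_ge0 R a c)
    (measurable_base_density a c) m (x, z)).
- by move=> y; rewrite mule_ge0 ?lee_fin ?chain_ge0//; exact: base_density_ge0.
rewrite -(weighted_integralZl (@unit_density_ge0 R c)
  (measurable_unit_density _) _ _ (powR_ge0 K (- s)));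
  last 2 first.
- apply: (measurableT_comp (measurable_path_kernel _ _ m)).
  apply/measurable_fun_pair => //=; apply: measurable_funM => //.
- by move=> r; exact: path_kernel_ge0.
apply: eq_integral => r _.
(* Since $K \ge 1$, the interval $[0,1)$ lies in the support of [subst_density], where the weight
   can vanish only through $r^c$; so [unit_density] vanishes too. *)
have [wz|wN0] := eqVneq (subst_density a c K r) 0%R.
  suff -> : nd r = 0%R by rewrite wz !mule0.
  move: wz; rewrite /subst_density /unit_density; case: (boolP (0 <= r < 1)%R) => //.
  move=> /andP[r0]; rewrite lt1a// => r1.
  have rK : (r ^+ a < K)%R by rewrite (lt_le_trans r1).
  rewrite r0 rK/= /subst_weight => /eqP; rewrite mulf_eq0 => /orP[/eqP//|].
  by rewrite gt_eqF// powR_gt0// mul1r subr_gt0.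
have [r0 q0] := subst_density_neq0 wN0; set q := (K - 1 * r ^+ a)%R in q0.
have y0 : (0 <= root_subst a K 1 r)%R by rewrite mulr_ge0 ?powR_ge0.
(* The reason for this choice of [K]: taking $a$-th powers, $x^ar^a < K - r^a$ says $Kr^a < K$. *)
have -> : (x * root_subst a K 1 r < 1)%R = (r < 1)%R.
  rewrite (lt1a (x * _)%R) ?(mulr_ge0 x0 y0)//.
  rewrite exprMn root_subst_expr// mulrA ltr_pdivrMr// (lt1a _ r0).
  by rewrite -[in RHS](ltr_pM2l K0) /q /K; apply/idP/idP; lra.
rewrite /unit_density r0/=; case: (ltP r 1%R) => r1; last by rewrite mul0e mul0e mule0.
rewrite mul1e IH// root_subst1_ratio// root_subst_expr//.
have -> : (r ^+ a / q / (K / q) = r ^+ a * (1 - x ^+ a / K))%R.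
  rewrite (_ : 1 - x ^+ a / K = K^-1)%R; last by rewrite /K; field; rewrite gt_eqF.
  by field; rewrite !gt_eqF.
rewrite -/K muleAC [RHS]muleAC -!EFinM; congr (_%:E * _).
move: wN0; rewrite /subst_density; case: ifP => [_ _|]; last by rewrite eqxx.
rewrite /subst_weight -/q mulrCA -powRM ?divr_ge0 ?(ltW q0) ?(ltW K0)//.
by rewrite divfK ?gt_eqF// mulrC.
Qed.

(** The starting point is substituted with $K = 1$, so its coordinate is $p = r^a$, and the
    prefactor $(1+x^a)^{-s}$ cancels against the weight $(1-r^a)^{-s}$. *)
Lemma chain_base_density_diag m :
  weighted_integral (@base_density R a c) (fun x => chain (@base_density R a c) m (x, x)) =
  weighted_integral nd (fun r => U m (r ^+ a, r ^+ a)%R).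
Proof.
rewrite [LHS](@integral_transfer R a c a_gt0 1 (fun x =>
  chain (base_density a c) m (x, x)))//; last 2 first.
- exact: (measurable_chain_diag (@base_density_ge0 R a c) (measurable_base_density a c) m).
- by move=> y; rewrite chain_ge0//; exact: base_density_ge0.
apply: eq_integral => r _.
have [wz|wN0] := eqVneq (subst_density a c 1 r) 0%R.
  suff -> : nd r = 0%R by rewrite wz !mule0.
  move: wz; rewrite /subst_density /unit_density; case: (boolP (0 <= r < 1)%R) => //.
  move=> /andP[r0 r1].
  have rK : (r ^+ a < 1)%R by rewrite expr_lt1.
  rewrite r0 rK/= /subst_weight => /eqP; rewrite mulf_eq0 => /orP[/eqP//|].
  by rewrite gt_eqF// powR_gt0// mul1r subr_gt0.
have [r0 q0] := subst_density_neq0 wN0.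
have y0 : (0 <= root_subst a 1 1 r)%R by rewrite mulr_ge0 ?powR_ge0.
have r1 : (r < 1)%R by rewrite -(expr_lt1 a_gt0 r0) -subr_gt0 -[X in (_ - X)%R]mul1r.
rewrite chain_base_density// root_subst1_ratio// root_subst_expr// /unit_density r0 r1/=.
set q := (1 - 1 * r ^+ a)%R in q0 *.
have -> : (r ^+ a / q / (1 / q) = r ^+ a)%R by field; rewrite gt_eqF.
rewrite muleAC -!EFinM muleC; congr (_ * _%:E).
rewrite /subst_density r0 expr_lt1// r1/= /subst_weight -/q.
rewrite mulrCA -powRM ?divr_ge0 ?(ltW q0)//.
by rewrite divfK ?gt_eqF// powR1 mulr1.
Qed.

End kernel.

(** * Closing the cycle: the trace as an integral over the unit cube *)

Section trace.
Variables (R : realType) (a c : nat).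
Hypothesis a_gt0 : (0 < a)%N.

Notation s := (c.+1%:R / a%:R : R).
Notation mu := (@lebesgue_measure R).
Notation nd := (@unit_density R c).
Notation U := (@path_kernel R a c).

Local Open Scope ereal_scope.

                                                                          
                                                
(** The trace is the case [al = 0], [be = 1]; a general affine function of $r^a$ as starting point
    is what makes the recursion in [m] close. *)
Definition cyclic_integral m (al be : R) : \bar R :=
  weighted_integral nd (fun r => U m (al + be * r ^+ a, r ^+ a)%R).

Lemma measurable_path_kernel_comp d (T : measurableType d) m (f g : T -> R) :
  measurable_fun setT f -> measurable_fun setT g ->
  measurable_fun setT (fun x => U m (f x, g x)).
Proof.
move=> mf mg; apply: (measurableT_comp (measurable_path_kernel _ _ m)).
exact/measurable_fun_pair.
Qed.

(** Tonelli moves the integral over [q] outside, and $q^a(1-(\alpha+\beta r^a))$ is again affine in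
    $r^a$. *)
Lemma cyclic_integralS m al be : cyclic_integral m.+1 al be =
  weighted_integral nd (fun q => cyclic_integral m (q ^+ a * (1 - al)) (- (q ^+ a * be)))%R.
Proof.
rewrite /cyclic_integral /=.
rewrite (weighted_integral_swap (w1 := nd) (w2 := nd) (f := fun p : R * R =>
  U m (p.2 ^+ a * (1 - (al + be * p.1 ^+ a)), p.1 ^+ a)%R)).
- apply: eq_weighted_integral => q _; apply: eq_weighted_integral => r _.
  by congr (U m (_, _)); ring.
- exact: unit_density_ge0.
- exact: unit_density_ge0.
- exact: measurable_unit_density.
- exact: measurable_unit_density.
- apply: measurable_path_kernel_comp.
    apply: measurable_funM; first exact: measurable_funX.
    apply: measurable_funB => //; apply: measurable_funD => //.
    by apply: measurable_funM => //; exact: measurable_funX.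
  exact: measurable_funX.
- by move=> p; exact: path_kernel_ge0.
Qed.

                                                                   
(** The closing constraint cuts $r$ at a point [t] that [root_subst (1 - al) be] sends exactly to
    $1$, and the same substitution absorbs the power $(1-p)^{-s}$. That is why [al] survives only
    through the hypotheses. *)
Lemma cyclic_integral0 al be : (0 <= al < 1)%R -> (0 <= al + be <= 1)%R ->
  cyclic_integral 0 al be = weighted_integral nd (fun x => ((1 + be * x ^+ a)^-1)%:E).
Proof.
move=> /andP[al0 al1] /andP[be0 be1].
pose K : R := (1 - al)%R; have K0 : (0 < K)%R by rewrite subr_gt0.
have b1 : (0 < 1 + be)%R by rewrite /K in K0; lra.
(* The root of $\alpha + \beta t^a + t^a = 1$; it is at most $1$ because $\alpha+\beta \ge 0$. *)
pose t : R := ((K / (1 + be)) `^ a%:R^-1)%R.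
have Kb : (0 < K / (1 + be))%R by rewrite divr_gt0.
have t0 : (0 <= t)%R by exact: powR_ge0.
have ta : (t ^+ a = K / (1 + be))%R.
  rewrite -powR_mulrn// -powRrM mulVf ?powRr1 ?(ltW Kb)//.
  by rewrite pnatr_eq0 -lt0n.
have t1 : (t <= 1)%R.
  rewrite -(expr_le1 a_gt0)// ta ler_pdivrMr// mul1r.
  by rewrite /K; lra.
have qt : (K - be * t ^+ a = K / (1 + be))%R by rewrite ta; field; rewrite gt_eqF.
have q0 (r : R) : (0 <= r <= t -> 0 < K - be * r ^+ a)%R.
  move=> /andP[r0 rt].
  have ra : (0 <= r ^+ a)%R by rewrite exprn_ge0.
  have rta : (r ^+ a <= t ^+ a)%R by rewrite lerXn2r ?nnegrE.
  have := Kb; rewrite -qt.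
  by case: (leP be 0%R) => b0 ?; nra.
have covt : root_subst a K be t = 1%R.
  rewrite /root_subst qt /t powRN divff// powR_eq0 negb_and gt_eqF//.
have G0 (x : R) : (0 <= x <= 1 -> 0 < 1 + be * x ^+ a)%R.
  move=> /andP[x0 x1]; have xa : (0 <= x ^+ a)%R by rewrite exprn_ge0.
  have xa1 : (x ^+ a <= 1)%R by rewrite exprn_ile1.
  by case: (leP be 0%R) => b0; nra.
have mG : measurable_fun (`[0%R, 1%R]%classic : set R)
    (fun x : R => x ^+ c / (1 + be * x ^+ a))%R.
  apply: subspace_continuous_measurable_fun; first exact: measurable_itv.
  apply: continuous_in_subspaceT => x; rewrite inE/= in_itv/= => /G0 xp.
  apply: cvgM; first exact: exprn_continuous.
  apply: cvgV; first by rewrite gt_eqF.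
  have := @continuous_root_subst_base R a 1 (- be) x; rewrite /continuous_at mulNr opprK.
  by under eq_fun do rewrite mulNr opprK.
transitivity (\int[mu]_(x in `[0%R, 1%R]) (x ^+ c / (1 + be * x ^+ a))%:E); last first.
  rewrite -integral_itv_bndo_bndc; last first.
    apply/measurable_EFinP; apply: measurable_funS mG => //.
    exact: subset_itv_co_cc.
  rewrite integral_mkcond; apply: eq_integral => x _.
  rewrite patchE mem_setE in_itv/= /unit_density; case: ifP => // _.
  by rewrite -EFinM mulrC.
  by rewrite mule0.
rewrite -[X in `[_, X]]covt integral_root_subst//; last by rewrite covt.
rewrite -integral_itv_bndo_bndc; last first.
  apply/measurable_EFinP/measurable_funTS; apply: measurable_funM.
    exact: measurable_funX.
  exact: measurable_powR_base.
rewrite [RHS]integral_mkcond; apply: eq_integral => r _.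
rewrite patchE mem_setE in_itv/= /unit_density.
case: (leP 0%R r) => r0/=; last by rewrite mule0.
have E : (al + be * r ^+ a + r ^+ a < 1)%R = (r < t)%R.
  rewrite -[RHS](ltr_pXn2r a_gt0) ?nnegrE// ta ltr_pdivlMr// /K.
  by apply/idP/idP; lra.
rewrite E; case: (ltP r t) => [rt|_]; last by rewrite mulr0 mul0e.
by rewrite (lt_le_trans rt t1) mulr1 -EFinM mulrC opprD addrA.
Qed.

                                                                           
               
(** The integral of $\phi(v(q_0\cdots q_m)^a)$ against $\prod q_i^c\,dq_i$ over the unit cube; note
    the [m.+1] variables. *)
Fixpoint iter_integral (phi : R -> \bar R) m (v : R) : \bar R :=
  if m is m'.+1 then weighted_integral nd (fun q => iter_integral phi m' (q ^+ a * v)%R)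
  else weighted_integral nd (fun q => phi (q ^+ a * v)%R).

Lemma nd_expr (q : R) : nd q != 0%R -> (0 <= q ^+ a < 1)%R.
Proof. by move=> /unit_density_neq0 /andP[q0 q1]; rewrite exprn_ge0//= expr_lt1. Qed.

(** Each step flips the sign of $\beta$ and multiplies its size by $q^a$. The bounds persist because
    both $\alpha$ and $\alpha+\beta$ move by $u \mapsto q^a(1-u)$. *)
Lemma cyclic_integral_iter_integral m (e : nat) (al v : R) : (0 <= al < 1)%R -> (0 <= v)%R ->
  (0 <= al + (-1) ^+ e * v <= 1)%R ->
  cyclic_integral m al ((-1) ^+ e * v)%R =
  iter_integral (fun y => ((1 + (-1) ^+ (e + m) * y)^-1)%:E) m v.
Proof.
elim: m e al v => [|m IH] e al v /andP[al0 al1] v0 /andP[b0 b1].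
  rewrite cyclic_integral0 ?al0 ?al1 ?b0 ?b1// addn0 /=.
  by apply: eq_weighted_integral => x _; rewrite -mulrA (mulrC v).
rewrite cyclic_integralS /=; apply: eq_weighted_integral => q /nd_expr/andP[q0 q1].
have -> : (- (q ^+ a * ((-1) ^+ e * v)) = (-1) ^+ e.+1 * (q ^+ a * v))%R.
  by rewrite exprS; ring.
rewrite IH ?mulr_ge0//; first by rewrite addSnnS.
- by rewrite /=; nra.
- by rewrite subr_ge0 ltW.
have -> : (q ^+ a * (1 - al) + (-1) ^+ e.+1 * (q ^+ a * v) =
  q ^+ a * (1 - (al + (-1) ^+ e * v)))%R by rewrite exprS; ring.
by rewrite mulr_ge0 ?subr_ge0//=; nra.
Qed.

Lemma chain_base_density_iter_integral m :
  weighted_integral (@base_density R a c) (fun x => chain (@base_density R a c) m (x, x)) =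
  iter_integral (fun y => ((1 + (-1) ^+ m * y)^-1)%:E) m 1.
Proof.
rewrite chain_base_density_diag// -[m in RHS]add0n.
rewrite -(@cyclic_integral_iter_integral m 0 0 1)//=.
- by apply: eq_weighted_integral => x _; rewrite add0r expr0 !mul1r.
- by rewrite lexx ltr01.
- by rewrite expr0 add0r mul1r ler01 lexx.
Qed.

End trace.

(** * Geometric expansion of the cube integral *)

Section iter_integral_series.
Variables (R : realType) (a c : nat).
Hypothesis a_gt0 : (0 < a)%N.

Notation mu := (@lebesgue_measure R).
Notation nd := (@unit_density R c).
Notation iter_integral := (@iter_integral R a c).

Local Open Scope ereal_scope.

Lemma iter_integral_ge0 (phi : R -> \bar R) m (v : R) :
  (forall y, 0 <= phi y) -> 0 <= iter_integral phi m v.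
Proof.
move=> phi0; elim: m v => [|m IH] v /=; apply: weighted_integral_ge0 => //;
  exact: unit_density_ge0.
Qed.

Lemma measurable_iter_integral (phi : R -> \bar R) m :
  measurable_fun setT phi -> (forall y, 0 <= phi y) ->
  measurable_fun setT (iter_integral phi m).
Proof.
move=> mphi phi0.
have step (g : R -> \bar R) : measurable_fun setT g -> (forall y, 0 <= g y) ->
    measurable_fun setT (fun v => weighted_integral nd (fun q => g (q ^+ a * v)%R)).
  move=> mg g0.
  apply: (measurable_weighted_integral (@unit_density_ge0 R c)
    (measurable_unit_density _)
    (f := fun p : R * R => g (p.2 ^+ a * p.1)%R)) => //.
  apply: measurableT_comp => //; apply: measurable_funM => //.
  exact: measurable_funX.
elim: m => [|m IH]; first exact: step.
by apply: step => // y; exact: iter_integral_ge0.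
Qed.

Lemma measurable_iter_integral_scaled (phi : R -> \bar R) m (v : R) :
  measurable_fun setT phi -> (forall y, 0 <= phi y) ->
  measurable_fun setT (fun q : R => iter_integral phi m (q ^+ a * v)%R).
Proof.
move=> mphi phi0; apply: (measurableT_comp (measurable_iter_integral m mphi phi0)).
by apply: measurable_funM => //; exact: measurable_funX.
Qed.

Lemma measurable_scaled (phi : R -> \bar R) (v : R) :
  measurable_fun setT phi -> measurable_fun setT (fun q : R => phi (q ^+ a * v)%R).
Proof.
move=> mphi; apply: (measurableT_comp mphi).
by apply: measurable_funM => //; exact: measurable_funX.
Qed.

Lemma eq_iter_integral (phi psi : R -> \bar R) m v : (0 <= v <= 1)%R ->
  (forall y, (0 <= y < 1)%R -> phi y = psi y) ->
  iter_integral phi m v = iter_integral psi m v.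
Proof.
move=> + pp; elim: m v => [|m IH] v /andP[v0 v1] /=; apply: eq_weighted_integral => q;
  move=> /(nd_expr a_gt0)/andP[q0 q1].
  by apply: pp; rewrite mulr_ge0//=; nra.
by apply: IH; rewrite mulr_ge0//=; nra.
Qed.

Lemma iter_integralD (phi psi : R -> \bar R) m v :
  measurable_fun setT phi -> measurable_fun setT psi ->
  (forall y, 0 <= phi y) -> (forall y, 0 <= psi y) ->
  iter_integral (fun y => phi y + psi y) m v = iter_integral phi m v + iter_integral psi m v.
Proof.
move=> mphi mpsi phi0 psi0; elim: m v => [|m IH] v /=.
  by rewrite weighted_integralD//; [exact: unit_density_ge0|exact: measurable_unit_density|
    exact: measurable_scaled|exact: measurable_scaled].
rewrite -weighted_integralD//; last 6 first.
- exact: unit_density_ge0.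
- exact: measurable_unit_density.
- exact: measurable_iter_integral_scaled.
- exact: measurable_iter_integral_scaled.
- by move=> x; exact: iter_integral_ge0.
- by move=> x; exact: iter_integral_ge0.
by apply: eq_weighted_integral => q _; rewrite IH.
Qed.

Lemma iter_integral_nneseries (phi : nat -> R -> \bar R) m v :
  (forall n, measurable_fun setT (phi n)) -> (forall n y, 0 <= phi n y) ->
  iter_integral (fun y => \sum_(n <oo) phi n y) m v = \sum_(n <oo) iter_integral (phi n) m v.
Proof.
move=> mphi phi0; elim: m v => [|m IH] v /=.
  rewrite weighted_integral_nneseries//;
    [exact: unit_density_ge0|exact: measurable_unit_density|].
  by move=> n; exact: measurable_scaled.
rewrite -weighted_integral_nneseries//; last 4 first.
- exact: unit_density_ge0.
- exact: measurable_unit_density.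
- by move=> n; exact: measurable_iter_integral_scaled.
- by move=> n x; exact: iter_integral_ge0.
by apply: eq_weighted_integral => q _; rewrite IH.
Qed.

Lemma integral_unit_density_expr n :
  weighted_integral nd (fun q => ((q ^+ a) ^+ n)%:E) = ((a * n + c.+1)%:R^-1 : R)%:E.
Proof.
set N := (a * n + c)%N.
transitivity (\int[mu]_(x in `[0%R, 1%R]) (x ^+ N)%:E).
  rewrite -integral_itv_bndo_bndc; last first.
    by apply/measurable_EFinP/measurable_funTS; exact: measurable_funX.
  rewrite [RHS]integral_mkcond; apply: eq_integral => x _.
  rewrite patchE mem_setE in_itv/= /unit_density; case: ifP => _; last by rewrite mule0.
  by rewrite -EFinM -exprM -exprD.
pose F : R -> R := (fun x => N.+1%:R^-1 * x ^+ N.+1)%R.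
have dF (x : R) : is_derive x 1%R F (x ^+ N)%R.
  have -> : F = (N.+1%:R^-1 *: (@idfun R) ^+ N.+1)%R.
    by apply/funext => y; rewrite !fctE.
  apply: is_derive_eq; rewrite /GRing.scale /= mulr1 mulrA mulVf ?mul1r//.
have cF : continuous F.
  by move=> x; apply/differentiable_continuous/derivable1_diffP; have [] := dF x.
rewrite (@continuous_FTC2 R _ F)//.
- by rewrite /F expr1n mulr1 expr0n/= mulr0 sube0 addnS.
- by apply: continuous_subspaceT => x; exact: exprn_continuous.
- split.
  + by move=> x _; have [] := dF x.
  + by apply: cvg_at_right_filter; exact: cF.
  + by apply: cvg_at_left_filter; exact: cF.
- by move=> x _; rewrite derive1E; have [_ ->] := dF x.
Qed.

Definition moment n : R := (a * n + c.+1)%:R^-1.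

Lemma moment_ge0 n : (0 <= moment n)%R.
Proof. by rewrite invr_ge0. Qed.

Lemma weighted_integral_unit_density_scaled_expr n (k v : R) : (0 <= k)%R -> (0 <= v)%R ->
  weighted_integral nd (fun q => (k * (q ^+ a * v) ^+ n)%:E) = (k * v ^+ n * moment n)%:E.
Proof.
move=> k0 v0; rewrite EFinM -integral_unit_density_expr.
(* The absolute value changes nothing on the support and makes the integrand nonnegative on the
   whole line, as [weighted_integralZl] requires. *)
have -> : weighted_integral nd (fun q => ((q ^+ a) ^+ n)%:E) =
    weighted_integral nd (fun q => (`|q ^+ a| ^+ n)%:E).
  by apply: eq_weighted_integral => q /(nd_expr a_gt0)/andP[q0 _]; rewrite ger0_norm.
rewrite -weighted_integralZl//.
- apply: eq_weighted_integral => q /(nd_expr a_gt0)/andP[q0 _]; rewrite ger0_norm//.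
  by rewrite -EFinM exprMn; congr _%:E; ring.
- exact: unit_density_ge0.
- exact: measurable_unit_density.
- by apply/measurable_EFinP; apply: measurable_funX; apply: measurableT_comp.
- by rewrite mulr_ge0 ?exprn_ge0.
Qed.

Lemma iter_integral_expr n m (v : R) : (0 <= v)%R ->
  iter_integral (fun y => (`|y| ^+ n)%:E) m v = (v ^+ n * moment n ^+ m.+1)%:E.
Proof.
elim: m v => [|m IH] v v0 /=.
  rewrite expr1 -[X in (X * _)%:E]mul1r -weighted_integral_unit_density_scaled_expr//.
  apply: eq_weighted_integral => q /(nd_expr a_gt0)/andP[q0 _].
  by rewrite mul1r ger0_norm// mulr_ge0.
rewrite exprSr mulrA (mulrC (v ^+ n)%R).
rewrite -weighted_integral_unit_density_scaled_expr//; last first.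
  by rewrite exprn_ge0// moment_ge0.
apply: eq_weighted_integral => q /(nd_expr a_gt0)/andP[q0 _].
by rewrite IH ?mulr_ge0// mulrC.
Qed.

                                                                             
                                                         
(** On $[0,1)$ this is $y^n/(1+y)$, the size of the remainder of $\sum(-y)^i$ after [n] terms.
    Absolute value and [powR] keep it nonnegative and measurable on the whole line. *)
Definition alt_tail n (y : R) : \bar R := (`|y| ^+ n * (1 + `|y|) `^ (-1))%:E.

Lemma alt_tail_ge0 n y : 0 <= alt_tail n y.
Proof. by rewrite lee_fin mulr_ge0 ?exprn_ge0 ?powR_ge0. Qed.

Lemma measurable_normX n : measurable_fun setT (fun y : R => (`|y| ^+ n)%:E).
Proof.
by apply/measurable_EFinP; apply: measurable_funX; exact: normr_measurable.
Qed.

Lemma measurable_alt_tail n : measurable_fun setT (alt_tail n).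
Proof.
apply/measurable_EFinP; apply: measurable_funM.
  by apply: measurable_funX; exact: normr_measurable.
apply: (measurableT_comp (measurable_powR _)).
by apply: measurable_funD => //; exact: normr_measurable.
Qed.

Lemma iter_integral_alt_tailD n m :
  iter_integral (alt_tail n) m 1 + iter_integral (alt_tail n.+1) m 1 = (moment n ^+ m.+1)%:E.
Proof.
rewrite -iter_integralD; [|exact: measurable_alt_tail|exact: measurable_alt_tail|
  exact: alt_tail_ge0|exact: alt_tail_ge0].
rewrite -[X in X%:E]mul1r -[X in (X * _)%:E](expr1n _ n) -iter_integral_expr//.
congr (iter_integral _ m 1); apply/funext => y; rewrite -EFinD; congr _%:E.
have y1 : (0 < 1 + `|y|)%R by rewrite ltr_wpDr.
by rewrite powR_inv1 ?(ltW y1)// exprS; field; rewrite gt_eqF.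
Qed.

Lemma moment_le_harmonic n m : (moment n ^+ m.+1 <= harmonic n)%R.
Proof.
have M1 : (moment n <= harmonic n)%R.
  by rewrite /moment /harmonic/= lef_pV2 ?posrE ?ltr0n ?addnS// ler_nat ltnS; nia.
have H1 : (@harmonic R n <= 1)%R by rewrite /harmonic/= invf_le1 ?ltr0n// ler1n.
apply: (le_trans _ M1); rewrite exprS ler_piMr ?moment_ge0// exprn_ile1 ?moment_ge0//.
exact: le_trans M1 H1.
Qed.

(** The [n]-th partial sum differs from [l] by exactly $\pm$ the iterated integral of [alt_tail n],
    which is at most [moment n ^+ m.+1] and hence at most $1/(n+1)$. No absolute convergence enters,
    so [m = 0] is included. *)
Lemma iter_integral_alternating_cvg m (l : R) :
  iter_integral (fun y => ((1 + y)^-1)%:E) m 1 = l%:E ->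
  series (fun n => (-1) ^+ n * moment n ^+ m.+1)%R @ \oo --> l.
Proof.
move=> El.
have tail n : exists2 r : R, (0 <= r <= moment n ^+ m.+1)%R &
    iter_integral (alt_tail n) m 1 = r%:E.
  have := iter_integral_alt_tailD n m.
  have := iter_integral_ge0 m 1 (alt_tail_ge0 n).
  have := iter_integral_ge0 m 1 (alt_tail_ge0 n.+1).
  (* Two nonnegative extended reals with a finite sum are both finite. *)
  case: (iter_integral (alt_tail n) m 1) => [r| |]//;
  case: (iter_integral (alt_tail n.+1) m 1) => [r'| |]//.
  rewrite !lee_fin => r'0 r0 [rr]; exists r => //; apply/andP; split => //.
  by rewrite -rr lerDl.
have S n : exists2 r : R, (0 <= r <= moment n ^+ m.+1)%R &
    series (fun n => (-1) ^+ n * moment n ^+ m.+1)%R n = (l - (-1) ^+ n * r)%R.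
  suff [r Er rE] : exists2 r : R, iter_integral (alt_tail n) m 1 = r%:E &
      series (fun n => (-1) ^+ n * moment n ^+ m.+1)%R n = (l - (-1) ^+ n * r)%R.
    exists r => //; have [r' + Er'] := tail n.
    by move: Er; rewrite Er' => -[->].
  elim: n => [|n [r Er IH]].
    exists l; last by rewrite expr0 mul1r subrr /series/= big_geq.
    rewrite -El; apply: eq_iter_integral; first by rewrite ler01 lexx.
    move=> y /andP[y0 _]; rewrite /alt_tail expr0 mul1r ger0_norm//.
    by rewrite powR_inv1// addr_ge0.
  have [r' _ Er'] := tail n.+1; exists r' => //.
  have := iter_integral_alt_tailD n m; rewrite Er Er' -EFinD => -[rr].
  by rewrite seriesEnat/= big_nat_recr//= -[X in (X + _)%R]/(series _ n) IH -rr exprS; ring.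
have near_le (e : R) : (0 < e)%R -> \forall n \near \oo, (@harmonic R n < e)%R.
  move=> e0; have /cvgrPdist_lt/(_ _ e0) := @cvg_harmonic R.
  by apply: filterS => n; rewrite sub0r normrN ger0_norm// harmonic_ge0.
apply/cvgrPdist_le => e /near_le; apply: filterS => n /ltW; apply: le_trans.
have [r /andP[r0 rm] ->] := S n.
rewrite opprB addrC subrK normrM normrX normrN1 expr1n mul1r ger0_norm//.
by rewrite (le_trans rm)// moment_le_harmonic.
Qed.

(** All terms are nonnegative, so sum and integral commute. The geometric expansion is needed only
    on $[0,1)$, where the arguments of the integrand lie. *)
Lemma iter_integral_geometric_cvg m (l : R) :
  iter_integral (fun y => ((1 - y)^-1)%:E) m 1 = l%:E ->
  series (fun n => moment n ^+ m.+1)%R @ \oo --> l.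
Proof.
move=> El.
have E : \sum_(n <oo) (moment n ^+ m.+1)%:E = l%:E.
  rewrite -El (@eq_iter_integral _ (fun y => \sum_(n <oo) (`|y| ^+ n)%:E)).
  - rewrite iter_integral_nneseries.
    + by apply: eq_eseriesr => n _; rewrite iter_integral_expr// expr1n mul1r.
    + exact: measurable_normX.
    + by move=> n y; rewrite lee_fin exprn_ge0.
  - by rewrite ler01 lexx.
  - move=> y /andP[y0 y1]; rewrite ger0_norm//; apply/esym/cvg_lim => //.
    rewrite [X in X @ _ --> _](_ : _ = EFin \o series (geometric 1 y)); last first.
      apply/funext => n; rewrite /= sumEFin; congr _%:E.
      by apply: eq_bigr => i _; rewrite /geometric/= mul1r.
    apply: cvg_EFin; first exact: nearW.
    by rewrite -[X in _ --> X]mul1r; apply: cvg_geometric_series; rewrite ger0_norm.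
have u0 n : (0 <= n)%N -> xpredT n -> 0 <= (moment n ^+ m.+1)%:E.
  by rewrite lee_fin exprn_ge0// moment_ge0.
have := is_cvg_nneseries u0.
rewrite E => /fine_cvg; apply: cvg_trans.
apply: near_eq_cvg; apply: nearW => n.
by rewrite /= sumEFin.
Qed.

End iter_integral_series.

(** * Independence and laws as integral identities *)

Section independent_pair.
Local Open Scope ereal_scope.
Context d d' (T : measurableType d) (T' : measurableType d') (R : realType).
Variable P : probability T R.

(** The joint law agrees with the product of the laws on rectangles, hence everywhere; Tonelli does
    the rest. [Z] takes values in an arbitrary measurable space so that it can stand for the whole
    past. *)
Lemma integral_independent (Z : {RV P >-> T'}) (Y : {RV P >-> R})
    (h : T' * R -> \bar R) :
  (forall A B, measurable A -> measurable B ->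
     P (Z @^-1` A `&` Y @^-1` B) = P (Z @^-1` A) * P (Y @^-1` B)) ->
  measurable_fun setT h -> (forall x, 0 <= h x) ->
  \int[P]_w h (Z w, Y w) = \int[P]_w \int[distribution P Y]_y h (Z w, y).
Proof.
move=> indep mh h0.
have mZY : measurable_fun setT (fun w => (Z w, Y w)) by exact/measurable_fun_pair.
rewrite -(ge0_integral_pushforward mZY P measurableT mh (fun x _ => h0 x)).
rewrite -[RHS](ge0_integral_distribution Z
  (f := fun z => \int[distribution P Y]_y h (z, y))).
- rewrite -(fubini_tonelli1 (m1 := distribution P Z) (m2 := distribution P Y))//.
  apply: eq_measure_integral => A mA _; apply/esym.
  apply: product_measure_unique => //= A1 A2 mA1 mA2.
- exact: measurable_fun_fubini_tonelli_F.
- by move=> z; exact: integral_ge0.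
Qed.

End independent_pair.

Section law.
Local Open Scope ereal_scope.

Lemma integral_law (R : realType) (d : measure_display) (T : measurableType d)
    (P : probability T R) (Y : {RV P >-> R}) (w : R -> R) (f : R -> \bar R) :
  measurable_fun setT w -> (forall x, (0 <= w x)%R) -> has_density Y w ->
  measurable_fun setT f -> (forall x, 0 <= f x) ->
  \int[distribution P Y]_x f x = weighted_integral w f.
Proof.
move=> mw w0 Yw mf f0; rewrite ge0_integral_distribution//.
have mY : measurable_fun setT (Y : T -> measurableTypeR R).
  exact: (measurable_funPT Y).
rewrite -[LHS](ge0_integral_pushforward mY P measurableT mf (fun x _ => f0 x)).
exact: ge0_integral_density.
Qed.

End law.

(** * The cyclic event as a trace, integrating one variable at a time *)

Section cyclic_chain.
Context (R : realType) (d : measure_display) (T : measurableType d)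
  (P : probability T R) (m : nat) (X : 'I_m.+1 -> {RV P >-> R}) (w : R -> R).
Hypotheses (w0 : forall x, 0 <= w x) (mw : measurable_fun setT w).
Hypothesis indepX : mutually_independent X.
Hypothesis densX : forall i, has_density (X i) w.

Local Open Scope ereal_scope.

Definition upto j : {set 'I_m.+1} := finset (fun i : 'I_m.+1 => (i <= j)%N).

Definition cylinder j (A : 'I_m.+1 -> set R) : set T :=
  \bigcap_(i in [set` upto j]) (X i @^-1` A i).

(** A pi-system generating the sigma-algebra of [X 0], ..., [X j]. *)
Definition past j : set (set T) :=
  [set E | exists2 A, (forall i, measurable (A i)) & E = cylinder j A].

Lemma measurable_preimage_RV i (A : set R) : measurable A ->
  measurable (X i @^-1` A).
Proof. by move=> mA; rewrite -[X in measurable X]setTI; exact: measurable_funPT. Qed.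

Lemma past_measurable j : past j `<=` measurable.
Proof.
move=> _ [A mA ->]; apply: fin_bigcap_measurable; first exact: finite_finset.
by move=> i _; exact: measurable_preimage_RV.
Qed.

Lemma setI_closed_past j : setI_closed (past j).
Proof.
move=> _ _ [A mA ->] [B mB ->]; exists (fun i => A i `&` B i).
  by move=> i; exact: measurableI.
rewrite /cylinder; apply/seteqP; split => t /=.
  by move=> [tA tB] i iJ; split; [exact: tA|exact: tB].
by move=> tAB; split => i iJ; have [] := tAB _ iJ.
Qed.

Lemma past_setT j : past j setT.
Proof.
exists (fun=> setT) => //; apply/esym/seteqP; split => // t _ i _ //.
Qed.

Lemma past_RV j (i : 'I_m.+1) (A : set R) : (i <= j)%N -> measurable A -> past j (X i @^-1` A).
Proof.
move=> ij mA; exists (fun i' => if i' == i then A else setT).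
  by move=> i'; case: ifP.
apply/seteqP; split => t /=.
  by move=> tA i' _ /=; case: eqP => [->|].
by move=> /(_ i) /=; rewrite eqxx; apply; rewrite /upto inE.
Qed.

(** As functions of [E], both sides are finite measures; they agree on the pi-system [past j], hence
    on the sigma-algebra it generates. *)
Lemma independent_past j (B : set R) : (j < m)%N -> measurable B ->
  forall E, <<s past j >> E ->
  P (E `&` X (inord j.+1) @^-1` B) = P E * P (X (inord j.+1) @^-1` B).
Proof.
move=> jm mB E sE; set D := X (inord j.+1) @^-1` B.
have mD : measurable D by exact: measurable_preimage_RV.
pose p : {nonneg R} := NngNum (fine_ge0 (measure_ge0 P D)).
have pE : p%:num%:E = P D by rewrite /= fineK// fin_num_measure.
rewrite muleC -pE.
apply: (@g_sigma_algebra_measure_unique _ R T (past j) (@past_measurable j)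
  (fun=> setT) (fun=> past_setT j) _ (mrestr P mD) (mscale p P)) => //.
- by apply/seteqP; split => // t _; exists 0%N.
- exact: setI_closed_past.
- move=> _ [A mA ->].
  transitivity (P (cylinder j A `&` D)); first by [].
  transitivity (P D * P (cylinder j A)); last by rewrite -pE.
  (* Putting [B] in slot [j.+1] turns the intersection into a longer cylinder, to which mutual
     independence applies. *)
  pose A' i := if i == inord j.+1 then B else A i.
  have mA' i : measurable (A' i) by rewrite /A'; case: ifP.
  have jS : (inord j.+1 : 'I_m.+1) = j.+1 :> nat by rewrite inordK.
  have -> : cylinder j A `&` D = cylinder j.+1 A'.
    apply/seteqP; split => t /=.
      move=> [tA tD] i /=; rewrite inE => ij; rewrite /A'.
      case: eqP => [->//|/eqP iN]; apply: tA => /=; rewrite inE.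
      move: ij; rewrite leq_eqVlt => /orP[/eqP ij|//].
      by case/eqP: iN; apply: val_inj; rewrite /= ij jS.
    move=> tA; split.
      move=> i /=; rewrite inE => ij; have := tA i; rewrite /= inE (leqW ij).
      rewrite /A'; case: eqP => [ie|_]; last exact.
      by move: ij; rewrite ie jS ltnn.
    by have := tA (inord j.+1); rewrite /= inE jS leqnn /A' eqxx; apply.
  rewrite /cylinder !indepX// (bigD1 (inord j.+1)) ?inE ?jS//=.
  rewrite {1}/A' eqxx; congr (_ * _); apply: eq_big => [i|i].
    rewrite !inE leq_eqVlt; case: eqP => /= [ij|ij].
      by rewrite ij ltnn; apply/negbTE; rewrite negbK; apply/eqP/val_inj; rewrite /= jS.
    case: eqP => [ie|]; rewrite ?andbT ?andbF ?ltnS//.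
    by case: ij; rewrite ie jS.
  by move=> /andP[_ /negbTE iN]; rewrite /A' iN.
- by move=> k; rewrite /= /mrestr setTI; rewrite ltey_eq fin_num_measure.
Qed.

Definition link (i : 'I_m.+1) (t : T) : R := (X i t * X (ordS i) t < 1)%R%:R.

Definition links j (t : T) : R := \prod_(i < m.+1 | (i < j)%N) link i t.

Lemma links_ge0 j t : (0 <= links j t)%R.
Proof. by apply: prodr_ge0 => i _; rewrite ler0n. Qed.

Lemma measurable_RV_past j (i : 'I_m.+1) : (i <= j)%N ->
  measurable_fun [set: g_sigma_algebraType (past j)] (X i).
Proof.
move=> ij _ A mA; rewrite setTI; apply: sub_sigma_algebra.
exact: past_RV.
Qed.

Lemma measurable_links_past j : (j <= m)%N ->
  measurable_fun [set: g_sigma_algebraType (past j)] (links j).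
Proof.
move=> jm.
have -> : links j =
    fun t => (\prod_(i < m.+1) (if (i < j)%N then link i t else 1))%R.
  by apply/funext => t; rewrite /links big_mkcond.
refine (@measurable_prod _ (g_sigma_algebraType (past j)) R setT _ _
  (fun (i : 'I_m.+1) t => if (i < j)%N then link i t else 1%R) _) => i _.
case: (boolP (i < j)%N) => ij //=.
apply/measurable_EFinP; apply: measurable_lt1; apply: measurable_funM.
  exact: (measurable_RV_past (ltnW ij)).
by apply: (@measurable_RV_past j); rewrite /= modn_small// ltnS (leq_trans ij).
Qed.

Lemma links_step j t : (j < m)%N ->
  links j.+1 t = (links j t * (X (inord j) t * X (inord j.+1) t < 1)%R%:R)%R.
Proof.
move=> jm; have jE : (inord j : 'I_m.+1) = j :> nat by rewrite inordK// ltnS ltnW.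
rewrite /links (bigD1 (inord j)) ?jE//= mulrC; congr (_ * _)%R.
  apply: eq_bigl => i; rewrite ltnS leq_eqVlt.
  case: eqP => /= [ij|ij].
    by rewrite ij ltnn; apply/negbTE; rewrite negbK; apply/eqP/val_inj; rewrite /= jE.
  by case: eqP => [ie|]; rewrite ?andbT//; case: ij; rewrite ie jE.
rewrite /link (_ : ordS (inord j) = inord j.+1)//; apply: val_inj.
by rewrite /= jE inordK// modn_small.
Qed.

(** An interpolation: the first [j] links are still random, while the path from [X j] back to [X 0]
    is already integrated out. It runs from the trace at [j = 0] to the probability at [j = m]. *)
Definition partial_chain j : \bar R := \int[P]_t
  ((links j t)%:E * chain w (m - j) (X (inord j) t, X (inord 0) t)).

Lemma partial_chain_step j : (j < m)%N -> partial_chain j.+1 = partial_chain j.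
Proof.
move=> jm.
have mid : measurable_fun setT (id : T -> g_sigma_algebraType (past j)).
  move=> _ A sA; rewrite setTI preimage_id.
  exact: (smallest_sub (@sigma_algebra_measurable _ T) (@past_measurable j) sA).
(* The identity map into [T] with the coarser sigma-algebra: all variables up to index [j] become
   one random element, independent of the next variable. *)
pose Z : {RV P >-> g_sigma_algebraType (past j)} :=
  HB.pack (id : T -> g_sigma_algebraType (past j))
    (isMeasurableFun.Build _ _ _ _ _ mid).
pose c t y := ((X (inord j) t * y < 1)%R%:R)%:E * chain w (m - j.+1) (y, X (inord 0) t).
pose h (q : g_sigma_algebraType (past j) * R) : \bar R :=
  (links j q.1)%:E * c q.1 q.2.
have c0 t y : 0 <= c t y by rewrite mule_ge0 ?lee_fin ?chain_ge0.
have h0 q : 0 <= h q by rewrite mule_ge0 ?lee_fin ?links_ge0.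
have mh : measurable_fun setT h.
  apply: emeasurable_funM.
    apply/measurable_EFinP.
    apply: (measurableT_comp (measurable_links_past (ltnW jm))).
    exact: measurable_fst.
  apply: emeasurable_funM.
    apply: measurable_lt1; apply: measurable_funM.
      apply: (measurableT_comp (measurable_RV_past _)).
        by rewrite inordK// ltnS ltnW.
      exact: measurable_fst.
    exact: measurable_snd.
  apply: (measurableT_comp (measurable_chain w0 mw _)).
  apply/measurable_fun_pair; first exact: measurable_snd.
  apply: (measurableT_comp (measurable_RV_past _)); first by rewrite inordK.
  exact: measurable_fst.
transitivity (\int[P]_t h (Z t, X (inord j.+1) t)).
  apply: eq_integral => t _; rewrite /h /c /= links_step// EFinM muleA//.
rewrite integral_independent//; last first.
  by move=> A B sA mB; rewrite /= preimage_id; exact: independent_past.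
apply: eq_integral => t _; rewrite /h /=.
have mc : measurable_fun setT (c t).
  exact: (measurable_chain_step1 w0 mw (m - j.+1) (X (inord j) t, X (inord 0) t)).
rewrite (integral_law mw w0 (densX (inord j.+1)))//.
- rewrite weighted_integralZl ?links_ge0//; congr (_ * _).
  by rewrite -(subnSK jm).
- by apply: emeasurable_funM.
- by move=> y; rewrite mule_ge0 ?lee_fin ?links_ge0.
Qed.

Lemma partial_chain0 : partial_chain 0 = weighted_integral w (fun x => chain w m (x, x)).
Proof.
rewrite -(integral_law mw w0 (densX (inord 0)))//; last 2 first.
- exact: measurable_chain_diag.
- by move=> x; exact: chain_ge0.
rewrite ge0_integral_distribution//; last 2 first.
- exact: measurable_chain_diag.
- by move=> x; exact: chain_ge0.
apply: eq_integral => t _; by rewrite subn0 /links big1 ?mul1e.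
Qed.

Lemma measurable_cyclic_event : measurable (cyclic_event X).
Proof.
have -> : cyclic_event X = \bigcap_(i in [set: 'I_m.+1])
    [set t | (X i t * X (ordS i) t < 1)%R].
  by apply/seteqP; split => t /= tX i => [_|]; exact: tX.
apply: fin_bigcap_measurable; first exact: finite_finset.
move=> i _; rewrite -[X in measurable X]setTI.
have -> : [set t | (X i t * X (ordS i) t < 1)%R] =
    (fun t => (X i t * X (ordS i) t)%R) @^-1` `]-oo, 1%R[%classic.
  by apply/seteqP; split => t /=; rewrite in_itv.
have : measurable_fun setT (fun t => (X i t * X (ordS i) t)%R).
  by apply: measurable_funM; exact: measurable_funPT.
by apply => //; exact: measurable_itv.
Qed.

Lemma partial_chain_max : partial_chain m = P (cyclic_event X).
Proof.
rewrite -[X in P X]setIT -integral_indic//; last exact: measurable_cyclic_event.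
apply: eq_integral => t _; rewrite subnn/= -EFinM indicE; congr _%:E.
have mE : (inord m : 'I_m.+1) = m :> nat by rewrite inordK.
(* [links m] misses only the wrap-around link, which is supplied by [chain w 0] at the last and
   first variables. *)
have lastS : ordS (inord m : 'I_m.+1) = inord 0.
  by apply: val_inj; rewrite /= mE modnn inordK.
have [tX|tX] := pselect (cyclic_event X t).
  rewrite mem_set// /links big1 => [|i _]; last by rewrite /link tX.
  by rewrite mul1r -lastS tX.
rewrite memNset//; have [i iN] : exists i, ~~ (X i t * X (ordS i) t < 1)%R.
  by apply/not_existsP => iX; apply: tX => i; apply/negPn/negP; exact: iX.
have [im|mi] := ltnP i m.
  by rewrite /links (bigD1 i)//= /link (negbTE iN) !mul0r.
have -> : inord m = i.
  by apply: val_inj; rewrite /= mE; apply/eqP; rewrite eqn_leq mi -ltnS ltn_ord.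
rewrite -lastS (_ : inord m = i) ?(negbTE iN) ?mulr0//.
by apply: val_inj; rewrite /= mE; apply/eqP; rewrite eqn_leq mi -ltnS ltn_ord.
Qed.

Lemma probability_cyclic_event :
  P (cyclic_event X) = weighted_integral w (fun x => chain w m (x, x)).
Proof.
rewrite -partial_chain_max -partial_chain0.
have : (m <= m)%N by []; move: {1 3}m => j.
by elim: j => [//|j IH jm]; rewrite partial_chain_step// IH// ltnW.
Qed.

End cyclic_chain.

(** * The one-sided series as a normalised probability *)

Section one_sided.
Context (R : realType) (d : measure_display) (T : measurableType d)
  (P : probability T R) (a c m : nat) (C : R) (X : 'I_m.+1 -> {RV P >-> R}).
Hypotheses (a_gt0 : (0 < a)%N) (C_gt0 : 0 < C).

Lemma probability_cyclic_event_iter_integral :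
  iid_with_density X (fun x => C * base_density a c x) ->
  P (cyclic_event X) =
  ((C ^+ m.+1)%:E *
   iter_integral a c (fun y => ((1 + (-1) ^+ m * y)^-1)%:E) m 1)%E.
Proof.
move=> [indepX densX].
have mp := @measurable_base_density R a c.
have p0 := @base_density_ge0 R a c.
have mw : measurable_fun setT (fun x : R => C * base_density a c x).
  by apply: measurable_funM.
have w0 x : 0 <= C * base_density a c x by rewrite mulr_ge0 ?(ltW C_gt0).
rewrite (probability_cyclic_event w0 mw indepX densX) -chain_base_density_iter_integral//.
rewrite -weighted_integralZl//; last 3 first.
- exact: measurable_chain_diag.
- by move=> x; exact: chain_ge0.
- by rewrite exprn_ge0 ?ltW.
apply: eq_integral => x _; rewrite chain_scale ?ltW// exprSr !EFinM -!muleA.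
by rewrite (muleCA (chain _ _ _) C%:E).
Qed.

(** The sign $(-1)^m$ in the denominator selects the geometric series when $k = m+1$ is even and the
    alternating one when $k$ is odd. *)
Lemma one_sided_series :
  iid_with_density X (fun x => C * base_density a c x) ->
  series (fun n => (-1) ^+ (n * m.+1) * ((a * n + c.+1)%:R ^+ m.+1)^-1) @ \oo -->
    fine (P (cyclic_event X)) / C ^+ m.+1.
Proof.
move=> iX; have PE := probability_cyclic_event_iter_integral iX.
set ct := iter_integral _ _ _ _ _ in PE.
have Ck : 0 < C ^+ m.+1 by rewrite exprn_gt0.
(* Finiteness of the cube integral is read off from that of the probability, as $C^k > 0$. *)
have [l El] : exists l, ct = l%:E.
  have : P (cyclic_event X) \is a fin_num.
    by apply: fin_num_measure; case: iX => iX dX; exact: measurable_cyclic_event.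
  rewrite PE; case: (ct) => [l| |]; first by exists l.
    by rewrite gt0_muley ?lte_fin.
  by rewrite gt0_muleNy ?lte_fin.
rewrite PE El /= mulrC mulKf ?gt_eqF//.
have [mo|mo] := boolP (odd m).
  have /(iter_integral_geometric_cvg a_gt0) :
      iter_integral a c (fun y => ((1 - y)^-1)%:E) m 1 = l%:E.
    rewrite -El /ct; congr (iter_integral _ _ _ m 1); apply/funext => y.
    by rewrite -signr_odd mo expr1 mulN1r.
  apply: cvg_trans; apply: near_eq_cvg; apply: nearW => N.
  apply: eq_bigr => n _; rewrite -signr_odd oddM/= mo andbF expr0 mul1r.
  by rewrite /moment exprVn.
have /(iter_integral_alternating_cvg a_gt0) :
    iter_integral a c (fun y => ((1 + y)^-1)%:E) m 1 = l%:E.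
  rewrite -El /ct; congr (iter_integral _ _ _ m 1); apply/funext => y.
  by rewrite -signr_odd (negbTE mo) expr0 mul1r.
apply: cvg_trans; apply: near_eq_cvg; apply: nearW => N.
apply: eq_bigr => n _; rewrite -[(-1) ^+ (n * m.+1)]signr_odd oddM/= mo andbT signr_odd.
by rewrite /moment exprVn.
Qed.

End one_sided.

Unset Implicit Arguments.

Theorem mainTheorem3 (R : realType) (a k : nat)
    (d : measure_display) (T : measurableType d) (P : probability T R)
    (Xi Theta : 'I_k -> {RV P >-> R}) :
  (2 <= a)%N -> (1 <= k)%N ->
  iid_with_density Xi (density_Xi a) ->
  iid_with_density Theta (density_Theta a) ->
  int_sum_to
    (fun n : int => (-1 : R) ^ (n * k%:Z) / (a%:Z * n + 1)%:~R ^+ k)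
    ((pi / a%:R * (sin (pi / a%:R))^-1) ^+ k *
     (fine (P (cyclic_event Xi)) + fine (P (cyclic_event Theta)))).
Proof.
case: k Xi Theta => // m Xi Theta a2 _ iXi iTheta.
have a_gt0 : (0 < a)%N by rewrite (leq_trans _ a2).
pose C : R := a%:R / pi * sin (pi / a%:R).
have aR : 0 < a%:R :> R by rewrite ltr0n.
have s0 : 0 < sin (pi / a%:R) :> R.
  rewrite sin_gt0_pi// divr_gt0 ?pi_gt0//= ltr_pdivrMr// ltr_pMr ?pi_gt0//.
  by rewrite ltr1n.
have C0 : 0 < C by rewrite !mulr_gt0 ?invr_gt0 ?pi_gt0.
have CV : pi / a%:R * (sin (pi / a%:R))^-1 = C^-1.
  by rewrite /C invfM invf_div.
have dXi : density_Xi a = (fun x : R => C * base_density a 0 x).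
  apply/funext => x; rewrite /density_Xi /base_density; case: ifP => _; last by rewrite mulr0.
  by rewrite expr0 mul1r.
have dTheta : density_Theta a = (fun x : R => C * base_density a (a - 2) x).
  apply/funext => x; rewrite /density_Theta /base_density.
  by case: ifP => _; rewrite ?mulr0// mulrA.
rewrite dXi in iXi; rewrite dTheta in iTheta.
have lp := one_sided_series a_gt0 C0 iXi.
have ln := one_sided_series a_gt0 C0 iTheta.
exists (fine (P (cyclic_event Xi)) / C ^+ m.+1),
  (fine (P (cyclic_event Theta)) / C ^+ m.+1); split.
- apply: cvg_trans lp; apply: near_eq_cvg; apply: nearW => N.
  apply: eq_bigr => n _; rewrite -PoszM -exprnP; congr (_ / _ ^+ _).
- apply: cvg_trans ln; apply: near_eq_cvg; apply: nearW => N.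
  apply: eq_bigr => n _.
  (* As $a \ge 2$, the truncated [(a - 2).+1] is $a-1$. *)
  have -> : a%:Z * - (n.+1)%:Z + 1 = - (a * n + (a - 2).+1)%N%:Z by nia.
  (* The sign $(-1)^{(n+1)k}$ of the term and the $(-1)^k$ from the negative denominator combine to
     $(-1)^{nk}$. *)
  rewrite mulrNz -pmulrn mulNr -PoszM -exprnN.
  rewrite invr_sign [in RHS](exprNn (a * n + (a - 2).+1)%:R) invfM invr_sign.
  by rewrite mulSn exprD [X in _ = X * _]mulrC -[in RHS]mulrA signrMK.
- by rewrite CV exprVn -mulrDl mulrC.
Qed.
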